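(* Let $\mathbb{K}$ be an algebraically closed field of characteristic $0$. In the brackets below, brackets of basis vectors that are not listed are zero or deduced by skew-symmetry. (1) Assume that $p\ge 5$. A $2p$-dimensional Lie algebra of $\mathcal{C}_1(\mathcal{F}^{2p,2}_{p-1,2})$ is never rigid in $2Nilp_{2p}$. (2) Let $p=3$ and let $\mathfrak{g}_6$ be the Lie algebra of $\mathcal{C}_1(\mathcal{F}^{6,2}_{2,2})$ with basis $X_1,\dots,X_6$ given by $$[X_1,X_{2i}]=X_{2i+1}\ (i=1,2),\quad [X_2,X_6]=X_5,\quad [X_4,X_6]=X_3.$$ Then $\mathfrak{g}_6$ is rigid in $2Nilp_6$. (3) Let $p=4$ and let $\mathfrak{g}_8$ be the Lie algebra of $\mathcal{C}_1(\mathcal{F}^{8,2}_{3,2})$ with basis $X_1,\dots,X_8$ given by $$[X_1,X_{2i}]=X_{2i+1}\ (i=1,2,3),\quad [X_2,X_4]=X_7,\quad [X_4,X_8]=X_3,\quad [X_6,X_8]=X_5.$$ Then $\mathfrak{g}_8$ is rigid in $2Nilp_8$.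
   Context: $2Nilp_n$ is the algebraic variety of all skew-symmetric bilinear maps $\mu:\mathbb{K}^n\times\mathbb{K}^n\to\mathbb{K}^n$ satisfying $\mu(\mu(X,Y),Z)=0$ for all $X,Y,Z$ (viewed in $\mathbb{K}^{n^3}$ via structure constants); a Lie algebra $(\mathbb{K}^n,\mu)$ is identified with $\mu$. The group $GL(n,\mathbb{K})$ acts by $(f\cdot\mu)(X,Y)=f^{-1}\mu(f(X),f(Y))$. $\mu\in 2Nilp_n$ is rigid in $2Nilp_n$ if its orbit is Zariski open in $2Nilp_n$. For a nilpotent Lie algebra $\mathfrak{g}$ and $X\in\mathfrak{g}$, $c(X)$ is the decreasing sequence of the dimensions of the Jordan blocks of $\mathrm{ad}(X)$; the characteristic sequence of $\mathfrak{g}$ is $c(\mathfrak{g})=\max\{c(X): X\in\mathfrak{g}\setminus[\mathfrak{g},\mathfrak{g}]\}$ for the lexicographic order. $\mathcal{F}^{2p,2}_{p-1,2}$ is the family of $2p$-dimensional $2$-step nilpotent Lie algebras over $\mathbb{K}$ with characteristic sequence $(2,\dots,2,1,1)$, where $2$ appears $p-1$ times. Let $\mu_0$ be the bracket of the $2p$-dimensional Lie algebra $\mathfrak{g}_{p-1,2}$ with basis $X_1,\dots,X_{2p}$ and brackets $[X_1,X_{2i}]=X_{2i+1}$, $1\le i\le p-1$, the others being zero or deduced by skew-symmetry. $\mathcal{C}_1(\mathcal{F}^{2p,2}_{p-1,2})$ is the set of Lie algebras of $\mathcal{F}^{2p,2}_{p-1,2}$ isomorphic to one with bracket $\mu_0+\varphi$,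 where $\varphi$ is a skew-symmetric bilinear map of the form $$\varphi(X_{2i},X_{2j})=\sum_{k=1}^{p-1}a_{2i,2j}^{2k+1}X_{2k+1},\quad 1\le i<j\le p,$$ with coefficients in $\mathbb{K}$, all values of $\varphi$ on pairs of basis vectors not defined by this formula being zero or obtained by skew-symmetry. *)

(* Defs.v *)
From mathcomp Require Import all_boot all_order all_algebra.
From mathcomp Require Import mpoly.

Set Implicit Arguments.
Unset Strict Implicit.
Unset Printing Implicit Defensive.

Import GRing.Theory.
Local Open Scope ring_scope.

Section TwoStepNilpotent.
Variable K : fieldType.

(* A bilinear map on K^n is represented by its values on pairs of vectors of
   the canonical basis; vectors are columns. *)
Definition bilin (n : nat) := {ffun 'I_n * 'I_n -> 'cV[K]_n}.

Definition bracket n (mu : bilin n) (X Y : 'cV[K]_n) : 'cV[K]_n :=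
  \sum_i \sum_j (X i 0 * Y j 0) *: mu (i, j).

Definition two_nilp n (mu : bilin n) : Prop :=
  (forall X Y, bracket mu X Y = - bracket mu Y X) /\
  (forall X Y Z, bracket mu (bracket mu X Y) Z = 0).

(* (f . mu)(X, Y) = f^-1 (mu (f X, f Y)), evaluated on the canonical basis *)
Definition gl_act n (f : 'M[K]_n) (mu : bilin n) : bilin n :=
  [ffun ij => invmx f *m
     bracket mu (f *m delta_mx ij.1 0) (f *m delta_mx ij.2 0)].

Definition gl_orbit n (mu nu : bilin n) : Prop :=
  exists2 f : 'M[K]_n, f \in unitmx & nu = gl_act f mu.

Definition lie_isomorphic n (mu nu : bilin n) : Prop :=
  exists2 f : 'M[K]_n, f \in unitmx &
    forall X Y, f *m bracket mu X Y = bracket nu (f *m X) (f *m Y).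

(* The structure constants of mu; there are #|'I_n * 'I_n * 'I_n| = n ^ 3 of
   them, numbered by the enumeration of the triples (i, j, k). *)
Definition str_consts n (mu : bilin n) (r : 'I_#|{: 'I_n * 'I_n * 'I_n}|) : K :=
  let: (i, j, k) := enum_val r in mu (i, j) k 0.

Definition zariski_closed n (Z : bilin n -> Prop) : Prop :=
  exists S : {mpoly K[#|{: 'I_n * 'I_n * 'I_n}|]} -> Prop,
    forall mu, Z mu <-> (forall q, S q -> q.@[str_consts mu] = 0).

Definition zariski_open_in n (V A : bilin n -> Prop) : Prop :=
  exists2 Z : bilin n -> Prop, zariski_closed Z &
    forall mu, A mu <-> V mu /\ ~ Z mu.

Definition rigid n (mu : bilin n) : Prop :=
  zariski_open_in (@two_nilp n) (gl_orbit mu).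

(* The derived algebra [g, g], as the smallest subspace containing all
   brackets. *)
Definition in_derived n (mu : bilin n) (X : 'cV[K]_n) : Prop :=
  forall U : {vspace 'cV[K]_n}, (forall Y Z, bracket mu Y Z \in U) -> X \in U.

Definition ad n (mu : bilin n) (X : 'cV[K]_n) : 'M[K]_n :=
  \matrix_(i, j) bracket mu X (delta_mx j 0) i 0.

(* For sumn s = n, the block diagonal matrix whose successive diagonal blocks
   are the nilpotent Jordan blocks of sizes s_0, s_1, etc.: reshape_index s i
   is the number of the block containing the index i. *)
Definition jordan_nilp n (s : seq nat) : 'M[K]_n :=
  \matrix_(i, j)
    ((j == i.+1 :> nat) && (reshape_index s i == reshape_index s j))%:R.

(* s is the decreasing sequence of the sizes of the Jordan blocks of the
   nilpotent matrix A. *)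
Definition jordan_sizes n (A : 'M[K]_n) (s : seq nat) : Prop :=
  [/\ sorted geq s, 0%N \notin s, sumn s = n & A ~_{in unitmx} jordan_nilp n s].

(* s = c(g) is the maximum of c(X) for X outside [g, g], lexicographically *)
Definition char_seq n (mu : bilin n) (s : seq nat) : Prop :=
  (exists2 X, ~ in_derived mu X & jordan_sizes (ad mu X) s) /\
  (forall X t, ~ in_derived mu X -> jordan_sizes (ad mu X) t ->
     ((t : seqlexi nat) <= (s : seqlexi nat))%O).

(* The family F^{2p,2}_{p-1,2} *)
Definition charseq_family (p : nat) (mu : bilin (2 * p)) : Prop :=
  two_nilp mu /\ char_seq mu (nseq p.-1 2%N ++ [:: 1%N; 1%N]).

(* Basis vectors are numbered from 1: X_k is the canonical vector of index
   k - 1. *)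
Definition basis_vec n (k : nat) : 'cV[K]_n := \col_i (i.+1 == k)%:R.

(* For a != b, the skew-symmetric bilinear map with [X_a, X_b] = v, the
   brackets of the other (unordered) pairs of basis vectors being zero *)
Definition elem_bracket n (a b : nat) (v : 'cV[K]_n) : bilin n :=
  [ffun ij : 'I_n * 'I_n =>
     (((ij.1.+1 == a) && (ij.2.+1 == b))%:R
      - ((ij.1.+1 == b) && (ij.2.+1 == a))%:R) *: v].

Definition mu0 (p : nat) : bilin (2 * p) :=
  \sum_(1 <= i < p) elem_bracket 1 (2 * i) (basis_vec (2 * p) (2 * i + 1)).

(* The scalar a i j k is the coefficient a_{2i,2j}^{2k+1}. *)
Definition phi (p : nat) (a : nat -> nat -> nat -> K) : bilin (2 * p) :=
  \sum_(1 <= i < p.+1) \sum_(i.+1 <= j < p.+1)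
    elem_bracket (2 * i) (2 * j)
      (\sum_(1 <= k < p) a i j k *: basis_vec (2 * p) (2 * k + 1)).

(* The set C_1(F^{2p,2}_{p-1,2}) *)
Definition C1 (p : nat) (mu : bilin (2 * p)) : Prop :=
  charseq_family mu /\
  exists a : nat -> nat -> nat -> K, lie_isomorphic mu (mu0 p + phi p a).

Definition g6 : bilin 6 :=
  elem_bracket 1 2 (basis_vec 6 3) + elem_bracket 1 4 (basis_vec 6 5)
  + elem_bracket 2 6 (basis_vec 6 5) + elem_bracket 4 6 (basis_vec 6 3).

Definition g8 : bilin 8 :=
  elem_bracket 1 2 (basis_vec 8 3) + elem_bracket 1 4 (basis_vec 8 5)
  + elem_bracket 1 6 (basis_vec 8 7) + elem_bracket 2 4 (basis_vec 8 7)
  + elem_bracket 4 8 (basis_vec 8 3) + elem_bracket 6 8 (basis_vec 8 5).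

End TwoStepNilpotent.

Arguments C1 {K} p mu.

(* Main.v *)
(* Write a 2-step nilpotent bracket near the given one as a net (A_k) of skew
   forms on a complement V of the space W where the brackets live, so that
   GL(V) x GL(W) acts on nets.
   (1) With dim V = p + 1 and dim W = p - 1, nets form a space of dimension
   p (p^2 - 1) / 2, and a fixed net is carried to others by polynomials in
   (p + 1)^2 + (p - 1)^2 parameters, fewer if p >= 5.  Hence some nonzero
   polynomial vanishes on all nets isomorphic to the given one, which therefore
   do not form a nonempty Zariski open set.
   (2), (3) Orbits are unions of translates of neighbourhoods, so it suffices to
   find a polynomial F, nonzero at g, such that every bracket with F <> 0 is
   isomorphic to g.  For p = 3 take the discriminant of the Pfaffian on the
   pencil: over a closed field the pencil then splits as (e0 ^ e1, e2 ^ e3).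
   For p = 4 the six polarized Pfaffian vectors P_kl of a net of forms on K^5
   satisfy a linear relation, that is, define a conic; if they span K^5 and the
   conic is nondegenerate, it can be brought to the form P_11 = -2 P_02, and
   then the cyclic relation A_i P_jk + A_j P_ki + A_k P_ij = 0 determines the
   net in the basis P_00, P_01, P_02, P_12, P_22, up to a scalar. *)
Require Import Defs.
From Stdlib Require Import Classical.
From mathcomp Require Import all_boot all_order all_algebra.
From mathcomp Require Import perm mpoly ring zify.

Set Implicit Arguments.
Unset Strict Implicit.
Unset Printing Implicit Defensive.

Import GRing.Theory.
Local Open Scope ring_scope.

(** * Brackets and neighbourhoods of orbits *)

Section Brackets.
Variables (K : fieldType) (n : nat).
Implicit Types (mu nu : bilin K n) (X Y Z : 'cV[K]_n) (f g : 'M[K]_n).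

Lemma col_sum_delta (X : 'cV[K]_n) : X = \sum_i X i 0 *: delta_mx i 0.
Proof.
rewrite [LHS]matrix_sum_delta; apply: eq_bigr => i _.
by rewrite big_ord_recl big_ord0 addr0.
Qed.

Lemma bracketDl mu X X' Y : bracket mu (X + X') Y = bracket mu X Y + bracket mu X' Y.
Proof.
rewrite /bracket -big_split; apply: eq_bigr => i _ /=.
by rewrite -big_split; apply: eq_bigr => j _ /=; rewrite mxE mulrDl scalerDl.
Qed.

Lemma bracketZl mu a X Y : bracket mu (a *: X) Y = a *: bracket mu X Y.
Proof.
rewrite /bracket scaler_sumr; apply: eq_bigr => i _.
by rewrite scaler_sumr; apply: eq_bigr => j _; rewrite mxE -mulrA scalerA.
Qed.

Lemma bracketDr mu X Y Y' : bracket mu X (Y + Y') = bracket mu X Y + bracket mu X Y'.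
Proof.
rewrite /bracket -big_split; apply: eq_bigr => i _ /=.
by rewrite -big_split; apply: eq_bigr => j _ /=; rewrite mxE mulrDr scalerDl.
Qed.

Lemma bracketZr mu a X Y : bracket mu X (a *: Y) = a *: bracket mu X Y.
Proof.
rewrite /bracket scaler_sumr; apply: eq_bigr => i _.
by rewrite scaler_sumr; apply: eq_bigr => j _; rewrite mxE mulrCA scalerA.
Qed.

Lemma bracket0l mu Y : bracket mu 0 Y = 0.
Proof. by have := bracketZl mu 0 0 Y; rewrite !scale0r. Qed.

Lemma bracket0r mu X : bracket mu X 0 = 0.
Proof. by have := bracketZr mu 0 X 0; rewrite !scale0r. Qed.

Lemma bracket_suml mu (I : finType) (F : I -> 'cV[K]_n) Y :
  bracket mu (\sum_i F i) Y = \sum_i bracket mu (F i) Y.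
Proof.
exact: (big_morph (fun X => bracket mu X Y) (fun X X' => bracketDl mu X X' Y) (bracket0l mu Y)).
Qed.

Lemma bracket_sumr mu (I : finType) (F : I -> 'cV[K]_n) X :
  bracket mu X (\sum_i F i) = \sum_i bracket mu X (F i).
Proof.
exact: (big_morph (bracket mu X) (bracketDr mu X) (bracket0r mu X)).
Qed.

Lemma bracket_delta mu i j : bracket mu (delta_mx i 0) (delta_mx j 0) = mu (i, j).
Proof.
rewrite /bracket (bigD1 i) //= [X in _ + X]big1 => [|i' /negPf ne_i].
  rewrite addr0 (bigD1 j) //= [X in _ + X]big1 => [|j' /negPf ne_j].
    by rewrite addr0 !mxE !eqxx mulr1 scale1r.
  by rewrite !mxE ne_j /= mulr0 scale0r.
by rewrite big1 // => j' _; rewrite !mxE ne_i mul0r scale0r.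
Qed.

Lemma eq_bracketP mu nu :
  (forall X Y, bracket mu X Y = bracket nu X Y) <-> mu = nu.
Proof.
split=> [E | -> //]; apply/ffunP => -[i j].
by rewrite -!bracket_delta.
Qed.

Lemma bracket_lin mu nu f :
    (forall i j, f *m mu (i, j) = bracket nu (col i f) (col j f)) ->
  forall X Y, f *m bracket mu X Y = bracket nu (f *m X) (f *m Y).
Proof.
move=> E X Y.
have colE Z : f *m Z = \sum_i Z i 0 *: col i f.
  by rewrite {1}[Z]col_sum_delta mulmx_sumr; apply: eq_bigr => i _; rewrite -scalemxAr colE.
rewrite {1}/bracket mulmx_sumr colE bracket_suml; apply: eq_bigr => i _.
rewrite mulmx_sumr colE bracket_sumr; apply: eq_bigr => j _.
by rewrite bracketZl bracketZr scalerA -E scalemxAr.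
Qed.

Lemma gl_act_morph f mu X Y : f \in unitmx ->
  f *m bracket (gl_act f mu) X Y = bracket mu (f *m X) (f *m Y).
Proof.
by move=> uf; apply: bracket_lin => i j; rewrite ffunE mulKVmx //= -!colE.
Qed.

Lemma gl_actE f mu X Y : f \in unitmx ->
  bracket (gl_act f mu) X Y = invmx f *m bracket mu (f *m X) (f *m Y).
Proof. by move=> uf; rewrite -gl_act_morph // mulKmx. Qed.

Lemma morph_gl_act f mu nu : f \in unitmx ->
    (forall X Y, f *m bracket nu X Y = bracket mu (f *m X) (f *m Y)) ->
  nu = gl_act f mu.
Proof.
by move=> uf E; apply/eq_bracketP => X Y; rewrite gl_actE // -E mulKmx.
Qed.

Lemma gl_act_comp f g mu : f \in unitmx -> g \in unitmx ->
  gl_act g (gl_act f mu) = gl_act (f *m g) mu.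
Proof.
move=> uf ug; apply: morph_gl_act => [|X Y]; first by rewrite unitmx_mul uf.
by rewrite -mulmxA gl_act_morph // gl_act_morph // !mulmxA.
Qed.

Lemma gl_act1 mu : gl_act 1%:M mu = mu.
Proof.
by symmetry; apply: morph_gl_act => [|X Y]; rewrite ?unitmx1 // !mul1mx.
Qed.

Lemma gl_orbit_sym mu nu : gl_orbit mu nu -> gl_orbit nu mu.
Proof.
case=> f uf ->; exists (invmx f); first by rewrite unitmx_inv.
by rewrite gl_act_comp ?unitmx_inv // mulmxV // gl_act1.
Qed.

Lemma gl_orbit_trans mu nu pi : gl_orbit mu nu -> gl_orbit nu pi -> gl_orbit mu pi.
Proof.
case=> f uf -> [g ug ->]; exists (f *m g); first by rewrite unitmx_mul uf.
exact: gl_act_comp.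
Qed.

Lemma lie_isomorphic_orbit mu nu : lie_isomorphic mu nu -> gl_orbit nu mu.
Proof. by case=> f uf E; exists f => //; apply: morph_gl_act. Qed.

Lemma two_nilp_act f mu : f \in unitmx -> two_nilp mu -> two_nilp (gl_act f mu).
Proof.
move=> uf [skew nil]; split=> [X Y | X Y Z]; rewrite !gl_actE //.
  by rewrite skew mulmxN.
by rewrite mulKVmx // nil mulmx0.
Qed.

End Brackets.

(** * Polynomial functions of the structure constants *)

Section PolynomialFunctions.
Variables (K : closedFieldType) (n : nat).
Implicit Types (mu nu : bilin K n) (F G : bilin K n -> K).

(** Only the existence of a polynomial is kept, so that closure rules reach determinants and
    adjugates without explicit polynomials. *)
Definition polyfun F :=
  exists q : {mpoly K[#|{: 'I_n * 'I_n * 'I_n}|]},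
    forall mu, F mu = q.@[str_consts mu].

Lemma eq_polyfun F G : F =1 G -> polyfun F -> polyfun G.
Proof. by move=> E [q qE]; exists q => mu; rewrite -E. Qed.

Lemma polyfun_const c : polyfun (fun=> c).
Proof. by exists c%:MP => mu; rewrite mevalC. Qed.

Lemma polyfun_coord i j k : polyfun (fun mu => mu (i, j) k 0).
Proof.
exists 'X_(enum_rank (i, j, k)) => mu.
by rewrite mevalXU /str_consts enum_rankK.
Qed.

Lemma polyfunD F G : polyfun F -> polyfun G -> polyfun (fun mu => F mu + G mu).
Proof. by move=> [p pE] [q qE]; exists (p + q) => mu; rewrite mevalD pE qE. Qed.

Lemma polyfunM F G : polyfun F -> polyfun G -> polyfun (fun mu => F mu * G mu).
Proof. by move=> [p pE] [q qE]; exists (p * q) => mu; rewrite mevalM pE qE. Qed.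

Lemma polyfunN F : polyfun F -> polyfun (fun mu => - F mu).
Proof. by move=> [p pE]; exists (- p) => mu; rewrite mevalN pE. Qed.

Lemma polyfun_sum (I : Type) (r : seq I) (P : pred I) (F : I -> bilin K n -> K) :
  (forall i, polyfun (F i)) -> polyfun (fun mu => \sum_(i <- r | P i) F i mu).
Proof.
move=> pF; elim: r => [|i r IHr].
  by apply: eq_polyfun (polyfun_const 0) => mu; rewrite big_nil.
case Pi: (P i); last by apply: eq_polyfun IHr => mu; rewrite big_cons Pi.
by apply: eq_polyfun (polyfunD (pF i) IHr) => mu; rewrite big_cons Pi.
Qed.

Lemma polyfun_prod (I : Type) (r : seq I) (P : pred I) (F : I -> bilin K n -> K) :
  (forall i, polyfun (F i)) -> polyfun (fun mu => \prod_(i <- r | P i) F i mu).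
Proof.
move=> pF; elim: r => [|i r IHr].
  by apply: eq_polyfun (polyfun_const 1) => mu; rewrite big_nil.
case Pi: (P i); last by apply: eq_polyfun IHr => mu; rewrite big_cons Pi.
by apply: eq_polyfun (polyfunM (pF i) IHr) => mu; rewrite big_cons Pi.
Qed.

Lemma polyfun_det m (A : bilin K n -> 'M[K]_m) :
  (forall i j, polyfun (fun mu => A mu i j)) -> polyfun (fun mu => \det (A mu)).
Proof.
move=> pA; apply: polyfun_sum => s; apply: polyfunM; first exact: polyfun_const.
by apply: polyfun_prod => i; apply: pA.
Qed.

Lemma polyfun_adj m (A : bilin K n -> 'M[K]_m) i j :
    (forall i j, polyfun (fun mu => A mu i j)) ->
  polyfun (fun mu => \adj (A mu) i j).
Proof.
move=> pA.
apply: (@eq_polyfun (fun mu => (-1) ^+ (j + i) * \det (row' j (col' i (A mu))))).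
  by move=> mu; rewrite mxE.
apply: polyfunM; first exact: polyfun_const.
by apply: polyfun_det => k l; apply: eq_polyfun (pA (lift j k) (lift i l)) => mu; rewrite !mxE.
Qed.

Lemma polyfun_mulmx m p q (A : bilin K n -> 'M[K]_(m, p)) (B : bilin K n -> 'M[K]_(p, q)) i j :
    (forall i j, polyfun (fun mu => A mu i j)) ->
    (forall i j, polyfun (fun mu => B mu i j)) ->
  polyfun (fun mu => (A mu *m B mu) i j).
Proof.
move=> pA pB; apply: (@eq_polyfun (fun mu => \sum_k A mu i k * B mu k j)).
  by move=> mu; rewrite mxE.
by apply: polyfun_sum => k; apply: polyfunM.
Qed.

(** For fixed [f] the structure constants of [gl_act f mu] are linear in those of [mu]; these linear
    forms are substituted into the polynomial of [F]. *)
Lemma polyfun_act (f : 'M[K]_n) F : polyfun F -> polyfun (fun mu => F (gl_act f mu)).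
Proof.
case=> q qE; pose c r mu := str_consts (gl_act f mu) r.
have pc r : polyfun (c r).
  rewrite /c /str_consts; case: (enum_val r) => -[i j] k.
  apply: (@eq_polyfun (fun mu => \sum_l invmx f k l * \sum_a \sum_b
      ((f *m delta_mx i 0) a 0 * (f *m delta_mx j 0) b 0 * mu (a, b) l 0))).
    move=> mu; rewrite /gl_act ffunE mxE; apply: eq_bigr => l _; congr (_ * _).
    rewrite /bracket summxE; apply: eq_bigr => a _; rewrite summxE.
    by apply: eq_bigr => b _; rewrite [RHS]mxE.
  apply: polyfun_sum => l; apply: polyfunM; first exact: polyfun_const.
  apply: polyfun_sum => a; apply: polyfun_sum => b.
  by apply: polyfunM; [apply: polyfun_const | apply: polyfun_coord].
apply: (@eq_polyfun (fun mu => \sum_(m <- msupp q) q@_m * \prod_r c r mu ^+ m r)).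
  by move=> mu; rewrite qE mevalE.
apply: polyfun_sum => m; apply: polyfunM; first exact: polyfun_const.
apply: polyfun_prod => r; apply: (@eq_polyfun (fun mu => \prod_(i < m r) c r mu)).
  by move=> mu; rewrite prodr_const card_ord.
exact: polyfun_prod.
Qed.

(* The orbit is the union of the translates of the neighbourhood F <> 0. *)
Lemma rigid_of_neighbourhood mu F :
    two_nilp mu -> polyfun F -> F mu != 0 ->
    (forall nu, two_nilp nu -> F nu != 0 -> gl_orbit mu nu) ->
  rigid mu.
Proof.
move=> mu2 pF Fmu orb.
(* The closed set is the common zero set of all translates of [F]. *)
exists (fun nu => forall f, f \in unitmx -> F (gl_act f nu) = 0).
  exists (fun q => exists2 f, f \in unitmx & forall nu, F (gl_act f nu) = q.@[str_consts nu]).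
  move=> nu; split=> [Z0 q [f uf <-]|S0 f uf]; first exact: Z0.
  by have [q qE] := polyfun_act f pF; rewrite qE; apply: S0; exists f.
move=> nu; split=> [[f uf ->] | [nu2 nZ]].
  split; first exact: two_nilp_act.
  move=> /(_ (invmx f)); rewrite unitmx_inv gl_act_comp ?unitmx_inv //.
  by rewrite mulmxV // gl_act1 => /(_ uf) /eqP; rewrite (negPf Fmu).
apply: NNPP => norb; apply: nZ => f uf; apply/eqP/negPn/negP => Ff.
have := orb _ (two_nilp_act uf nu2) Ff => orb_f; apply: norb.
by apply: gl_orbit_trans orb_f (gl_orbit_sym _); exists f.
Qed.

End PolynomialFunctions.

(** * Nets of bilinear forms *)

Lemma unitmx_inj (K : fieldType) n (f : 'M[K]_n) :
  (forall X : 'cV_n, f *m X = 0 -> X = 0) -> f \in unitmx.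
Proof.
move=> inj; rewrite -unitmx_tr -row_free_unit; apply: inj_row_free => v vf.
by apply: trmx_inj; rewrite trmx0; apply: inj; rewrite -[f]trmxK -trmx_mul vf trmx0.
Qed.

Section Nets.
Variable K : fieldType.

(** Equivalence under GL(V) x GL(W): [U] acts on V by congruence, [T] recombines the forms. *)
Definition net_equiv m q (A B : 'I_q -> 'M[K]_m) :=
  exists U : 'M[K]_m, exists T : 'M[K]_q,
    [/\ U \in unitmx, T \in unitmx &
        forall k, U^T *m A k *m U = \sum_l T k l *: B l].

Lemma net_equiv_sym m q (A B : 'I_q -> 'M[K]_m) : net_equiv A B -> net_equiv B A.
Proof.
case=> U [T [uU uT E]]; exists (invmx U), (invmx T); split; rewrite ?unitmx_inv // => k.
have A_E l : A l = (invmx U)^T *m (\sum_j T l j *: B j) *m invmx U.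
  by rewrite -E trmx_inv -!mulmxA mulmxV // mulmx1 mulKmx ?unitmx_tr.
transitivity ((invmx U)^T *m (\sum_l invmx T k l *: \sum_j T l j *: B j) *m invmx U).
  congr (_ *m _ *m _).
  transitivity (\sum_j ((invmx T *m T) k j) *: B j).
    rewrite mulVmx // (bigD1 k) //= big1 => [|j /negPf ne_jk].
      by rewrite mxE eqxx scale1r addr0.
    by rewrite mxE eq_sym ne_jk scale0r.
  under [RHS]eq_bigr do rewrite scaler_sumr.
  rewrite exchange_big; apply: eq_bigr => j _ /=; rewrite mxE scaler_suml.
  by apply: eq_bigr => l _; rewrite scalerA.
rewrite mulmx_sumr mulmx_suml; apply: eq_bigr => l _.
by rewrite A_E -scalemxAr -scalemxAl.
Qed.

Lemma net_equiv_trans m q (A B C : 'I_q -> 'M[K]_m) :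
  net_equiv A B -> net_equiv B C -> net_equiv A C.
Proof.
case=> U [T [uU uT EA]] [V [S [uV uS EB]]].
exists (U *m V), (T *m S); split; rewrite ?unitmx_mul ?uU ?uT // => k.
rewrite trmx_mul !mulmxA -(mulmxA V^T) -(mulmxA V^T) EA mulmx_sumr mulmx_suml.
under eq_bigr do rewrite -scalemxAr -scalemxAl EB scaler_sumr.
rewrite exchange_big; apply: eq_bigr => j _ /=; rewrite mxE scaler_suml.
by apply: eq_bigr => l _; rewrite scalerA.
Qed.

Lemma net_equiv_lin m q (A : 'I_q -> 'M[K]_m) (g : 'M[K]_q) :
  g \in unitmx -> net_equiv (fun k => \sum_l g k l *: A l) A.
Proof.
move=> ug; exists 1%:M, g; split; rewrite ?unitmx1 // => k.
by rewrite trmx1 mul1mx mulmx1.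
Qed.

Variables (m q n : nat) (h : 'I_m + 'I_q -> 'I_n) (h' : 'I_n -> 'I_m + 'I_q).
Hypotheses (hK : cancel h h') (h'K : cancel h' h).
Implicit Types (A : 'I_q -> 'M[K]_m) (nu : bilin K n).

(** For a general [nu] this forgets the V-coordinates of brackets and all brackets with W;
    [orbit_of_net_equiv] shows that the orbit can still be read off. *)
Definition net_of (nu : bilin K n) (k : 'I_q) : 'M[K]_m :=
  \matrix_(i, j) nu (h (inl i), h (inl j)) (h (inr k)) 0.

Definition bilin_of_net (A : 'I_q -> 'M[K]_m) : bilin K n :=
  [ffun xy => match h' xy.1, h' xy.2 with
    | inl i, inl j => \sum_k A k i j *: delta_mx (h (inr k)) 0
    | _, _ => 0
    end].

Lemma sum_split (V : nmodType) (F : 'I_n -> V) :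
  \sum_x F x = \sum_i F (h (inl i)) + \sum_k F (h (inr k)).
Proof.
rewrite (reindex h) /=; last by exists h' => x _; [apply: hK | apply: h'K].
by rewrite big_sumType.
Qed.

Let emb (x : 'cV[K]_m) : 'cV[K]_n := \sum_i x i 0 *: delta_mx (h (inl i)) 0.

Lemma h_eq x y : (h x == h y) = (x == y).
Proof. exact: can_eq hK x y. Qed.

Let emb_inl x i : emb x (h (inl i)) 0 = x i 0.
Proof.
rewrite summxE (bigD1 i) //= big1 => [|j /negPf ne_ji].
  by rewrite !mxE !eqxx mulr1 addr0.
by rewrite !mxE h_eq /= (inj_eq (@inl_inj _ _)) eq_sym ne_ji mulr0.
Qed.

Let emb_inr x k : emb x (h (inr k)) 0 = 0.
Proof. by rewrite summxE big1 // => j _; rewrite !mxE h_eq mulr0. Qed.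

Lemma col_split_eq (X Y : 'cV[K]_n) :
    (forall i, X (h (inl i)) 0 = Y (h (inl i)) 0) ->
    (forall k, X (h (inr k)) 0 = Y (h (inr k)) 0) -> X = Y.
Proof.
by move=> El Er; apply/colP => x; rewrite -(h'K x); case: (h' x).
Qed.

Let bracket_emb nu x y k :
  bracket nu (emb x) (emb y) (h (inr k)) 0 = (x^T *m net_of nu k *m y) 0 0.
Proof.
rewrite bracket_suml summxE -mulmxA mxE; apply: eq_bigr => i _.
rewrite bracketZl 2!mxE; congr (_ * _).
rewrite bracket_sumr summxE mxE; apply: eq_bigr => j _.
by rewrite bracketZr bracket_delta !mxE mulrC.
Qed.

Lemma bracket_of_netE A i j :
  bilin_of_net A (h (inl i), h (inl j)) = \sum_k A k i j *: delta_mx (h (inr k)) 0.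
Proof. by rewrite ffunE /= !hK. Qed.

Lemma net_of_bilin_of_net A k : net_of (bilin_of_net A) k = A k.
Proof.
apply/matrixP => i j; rewrite mxE bracket_of_netE summxE (bigD1 k) //= big1.
  by rewrite !mxE !eqxx mulr1 addr0.
move=> l /negPf ne_lk; rewrite !mxE h_eq (inj_eq (@inr_inj _ _)) eq_sym ne_lk.
by rewrite mulr0.
Qed.

Lemma bracket_of_net A X Y : bracket (bilin_of_net A) X Y =
  \sum_i \sum_j (X (h (inl i)) 0 * Y (h (inl j)) 0)
      *: \sum_k A k i j *: delta_mx (h (inr k)) 0.
Proof.
rewrite /bracket sum_split [X in _ + X]big1 ?addr0 => [|k _]; last first.
  by apply: big1 => y _; rewrite ffunE /= hK scaler0.
apply: eq_bigr => i _; rewrite sum_split [X in _ + X]big1 ?addr0 => [|k _]; last first.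
  by rewrite ffunE /= !hK scaler0.
by apply: eq_bigr => j _; rewrite bracket_of_netE.
Qed.

Lemma bracket_of_net_inl A X Y i : bracket (bilin_of_net A) X Y (h (inl i)) 0 = 0.
Proof.
rewrite bracket_of_net summxE big1 // => a _; rewrite summxE big1 // => b _.
by rewrite mxE summxE big1 ?mulr0 // => k _; rewrite !mxE h_eq mulr0.
Qed.

Lemma bracket_of_net_inr A X Y k : bracket (bilin_of_net A) X Y (h (inr k)) 0 =
  \sum_i \sum_j X (h (inl i)) 0 * Y (h (inl j)) 0 * A k i j.
Proof.
rewrite bracket_of_net summxE; apply: eq_bigr => a _; rewrite summxE.
apply: eq_bigr => b _; rewrite mxE; congr (_ * _).
rewrite -[RHS](congr1 (fun M : 'M_m => M a b) (net_of_bilin_of_net A k)) mxE.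
by rewrite bracket_of_netE.
Qed.

Lemma two_nilp_of_net A :
  (forall k i j, A k i j = - A k j i) -> two_nilp (bilin_of_net A).
Proof.
move=> skew; split=> [X Y | X Y Z].
  apply: col_split_eq => k; first by rewrite mxE !bracket_of_net_inl oppr0.
  rewrite mxE !bracket_of_net_inr exchange_big -sumrN; apply: eq_bigr => i _ /=.
  by rewrite -sumrN; apply: eq_bigr => j _; rewrite skew mulrN [X in X * _]mulrC.
rewrite bracket_of_net big1 // => i _; apply: big1 => j _.
by rewrite bracket_of_net_inl mul0r scale0r.
Qed.

Lemma net_of_skew nu k i j : two_nilp nu -> net_of nu k i j = - net_of nu k j i.
Proof. by case=> skew _; rewrite !mxE -!bracket_delta skew mxE. Qed.

(* A central vector without W-coordinates lies in the common radical of the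
   net, so W-coordinates separate the derived algebra.  The section s makes
   the images of the basis of W brackets of vectors of V. *)
Lemma orbit_of_net_equiv (G : 'I_q -> 'M[K]_m) (s : 'I_q -> 'I_m * 'I_m) (nu : bilin K n) :
    (forall k l, G k (s l).1 (s l).2 = (k == l)%:R) ->
    (forall w : 'rV_m, (forall k, w *m G k = 0) -> w = 0) ->
    two_nilp nu -> net_equiv (net_of nu) G ->
  gl_orbit (bilin_of_net G) nu.
Proof.
move=> sG radG [skew nil] [U [T [uU uT E]]].
pose central z := forall Y, bracket nu z Y = 0.
have central0 z : central z -> (forall k, z (h (inr k)) 0 = 0) -> z = 0.
  move=> cz z0; pose x := \col_i z (h (inl i)) 0.
  have zE : z = emb x.
    by apply: col_split_eq => k; rewrite ?emb_inl ?emb_inr ?z0 // mxE.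
  have xA k : x^T *m net_of nu k = 0.
    apply/rowP => j; rewrite mxE.
    have /(congr1 (fun Z : 'cV_n => Z (h (inr k)) 0)) := cz (emb (delta_mx j 0)).
    by rewrite zE bracket_emb -colE !mxE.
  pose w := x^T *m invmx U^T.
  have wG k : \sum_l T k l *: (w *m G l) = 0.
    under eq_bigr do rewrite scalemxAr.
    rewrite -mulmx_sumr -E /w !mulmxA mulmxKV ?unitmx_tr //.
    by rewrite xA mul0mx.
  (* Combining the relations [wG] with the coefficients of [invmx T] isolates each [w *m G l], so
     that [radG] applies. *)
  have w0 : w = 0.
    apply: radG => l; transitivity (\sum_k (invmx T l k *: \sum_j T k j *: (w *m G j))).
      under eq_bigr do rewrite scaler_sumr.
      rewrite exchange_big (bigD1 l) //= [X in _ = _ + X]big1 => [|j /negPf ne_jl].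
        under eq_bigr do rewrite scalerA.
        rewrite -scaler_suml.
        have /(congr1 (fun M : 'M_q => M l l)) := mulVmx uT.
        by rewrite !mxE eqxx => ->; rewrite scale1r addr0.
      under eq_bigr do rewrite scalerA.
      rewrite -scaler_suml.
      have /(congr1 (fun M : 'M_q => M l j)) := mulVmx uT.
      by rewrite !mxE eq_sym ne_jl => ->; rewrite scale0r.
    by apply: big1 => k _; rewrite wG scaler0.
  have x0 : x^T = 0 by rewrite -[x^T](mulmxKV (_ : U^T \in unitmx)) ?unitmx_tr // -/w w0 mul0mx.
  apply: col_split_eq => k; rewrite ?z0 [RHS]mxE //.
  by have := congr1 (fun M : 'rV_m => M 0 k) x0; rewrite !mxE.
(* The brackets of the [u i] need not lie in W, so W is replaced by the span of the brackets [w l],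
   which are central since [nu] is 2-step nilpotent. *)
pose u i := emb (col i U).
pose w l := bracket nu (u (s l).1) (u (s l).2).
have cent l : central (w l) by move=> Y; apply: nil.
have brE i j k : bracket nu (u i) (u j) (h (inr k)) 0 = \sum_l T k l * G l i j.
  have := congr1 (fun M : 'M_m => M i j) (E k).
  rewrite summxE => E'; transitivity (\sum_l (T k l *: G l) i j); last first.
    by apply: eq_bigr => l _; rewrite mxE.
  rewrite -E' bracket_emb tr_col -row_mul mxE [RHS]mxE.
  by apply: eq_bigr => l _; rewrite mxE [col _ _ _ _]mxE.
have wE l k : w l (h (inr k)) 0 = T k l.
  rewrite brE (bigD1 l) //= sG eqxx mulr1 big1 ?addr0 // => j /negPf ne_jl.
  by rewrite sG ne_jl mulr0.
(* Both sides are central and have the same W-coordinates by [brE] and [wE], so [central0]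
   identifies them. *)
have br i j : bracket nu (u i) (u j) = \sum_l G l i j *: w l.
  apply/eqP; rewrite -subr_eq0; apply/eqP; apply: central0 => [Y|k].
    rewrite -scaleN1r bracketDl bracketZl nil add0r bracket_suml big1 ?scaler0 // => l _.
    by rewrite bracketZl cent scaler0.
  rewrite mxE brE mxE summxE -sumrB big1 // => l _.
  by rewrite mxE wE mulrC subrr.
(* [f] sends the basis of V to the [u i] and that of W to the [w l], and so intertwines
   [bilin_of_net G] with [nu]. *)
pose f : 'M[K]_n := \matrix_(r, c) match h' c with inl i => u i r 0 | inr l => w l r 0 end.
have f_l i : col (h (inl i)) f = u i by apply/colP => r; rewrite !mxE hK.
have f_r l : col (h (inr l)) f = w l by apply/colP => r; rewrite !mxE hK.
have fE X : f *m X = emb (U *m \col_i X (h (inl i)) 0) + \sum_l X (h (inr l)) 0 *: w l.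
  rewrite {1}[X]col_sum_delta mulmx_sumr sum_split; congr (_ + _).
    under eq_bigr do rewrite -scalemxAr -colE f_l.
    apply: col_split_eq => k; last first.
      rewrite [RHS]emb_inr summxE big1 // => i _.
      by rewrite [LHS]mxE emb_inr mulr0.
    rewrite [RHS]emb_inl summxE mxE; apply: eq_bigr => i _.
    by rewrite [LHS]mxE emb_inl !mxE mulrC.
  by apply: eq_bigr => l _; rewrite -scalemxAr -colE f_r.
(* For a kernel vector, the part spanned by the [w l] is central without W-coordinates, hence zero;
   invertibility of [U] and [T] then kills all coordinates. *)
have uf : f \in unitmx.
  apply: unitmx_inj => X; rewrite fE; set x := \col_i _; set z := \sum_l _ => fX0.
  have z0 : z = 0.
    apply: central0 => [Y | k].
      by rewrite bracket_suml big1 // => l _; rewrite bracketZl cent scaler0.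
    have /(congr1 (fun Z : 'cV_n => Z (h (inr k)) 0)) := fX0.
    by rewrite mxE emb_inr add0r mxE.
  have Ux : U *m x = 0.
    apply/colP => i; have /(congr1 (fun Z : 'cV_n => Z (h (inl i)) 0)) := fX0.
    by rewrite z0 addr0 emb_inl => ->; rewrite !mxE.
  have x0 : x = 0 by rewrite -(mulKmx uU x) Ux mulmx0.
  pose c := \col_l X (h (inr l)) 0.
  have Tc : T *m c = 0.
    apply/colP => k; rewrite [RHS]mxE; transitivity (z (h (inr k)) 0).
      by rewrite mxE summxE; apply: eq_bigr => l _; rewrite !mxE wE mulrC.
    by rewrite z0 mxE.
  have c0 : c = 0 by rewrite -(mulKmx uT c) Tc mulmx0.
  apply: col_split_eq => k; rewrite [RHS]mxE.
    by have := congr1 (fun M : 'cV_m => M k 0) x0; rewrite !mxE.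
  by have := congr1 (fun M : 'cV_q => M k 0) c0; rewrite !mxE.
apply: gl_orbit_sym; exists f => //; apply: morph_gl_act => //.
apply: bracket_lin => x y; rewrite -(h'K x) -(h'K y) ffunE /= !h'K.
have central_r l Y : bracket nu Y (w l) = 0 by rewrite skew cent oppr0.
case: (h' x) (h'K x) => [i | k] <-; last first.
  by rewrite f_r cent mulmx0.
case: (h' y) (h'K y) => [j | k] <-; last by rewrite f_r central_r mulmx0.
rewrite !f_l br mulmx_sumr; apply: eq_bigr => l _.
by rewrite -scalemxAr -colE f_r.
Qed.

End Nets.

(** * Congruence of symmetric matrices *)

Section SymmetricCongruence.
Variable K : closedFieldType.
Hypothesis two_neq0 : 2 != 0 :> K.

Lemma closed_sqrt (a : K) : exists r, r ^+ 2 = a.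
Proof.
have [r rE] := @solve_monicpoly K 2 (nth 0 [:: a]) isT.
by exists r; rewrite rE !big_ord_recl big_ord0 /= mul0r mulr1 !addr0.
Qed.

(** The rank decomposition of the row [v] completes it to a basis; [c] is the inverse of the 1 x 1
    column factor. *)
Lemma unitmx_first_row n (v : 'rV[K]_(1 + n)) :
  v != 0 -> exists c, exists2 P, P \in unitmx & row 0 P = c *: v /\ c != 0.
Proof.
move=> v0; have rv : \rank v = 1%N by rewrite rank_rV v0.
have := mulmx_ebase v; rewrite rv [col_ebase v]mx11_scalar mul_scalar_mx -scalemxAl.
set a := col_ebase v 0 0; set P := row_ebase v => vE.
have a0 : a != 0.
  by apply: contraNneq v0 => a0; rewrite -vE a0 scale0r.
exists a^-1, P; first exact: row_ebase_unit.
split; last by rewrite invr_eq0.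
rewrite -{}vE scalerA mulVf // scale1r rowE; congr (_ *m _).
by apply/rowP => j; rewrite !mxE /= andbT eq_sym.
Qed.

(** Cholesky-like induction: a non-isotropic vector is put first, its value has a square root [r],
    and the Schur complement, possibly degenerate, is left to the induction hypothesis. *)
Lemma symmetric_congruent1 n (S : 'M[K]_n) : S^T = S -> exists P : 'M_n, S = P^T *m P.
Proof.
elim: n => [|n IHn] in S *; first by move=> _; exists 0; rewrite flatmx0 [RHS]flatmx0.
move=> symS; have symE i j : S i j = S j i by rewrite -{1}symS mxE.
have [-> | S0] := eqVneq S 0; first by exists 0; rewrite mulmx0.
(* If [S i i] and [S j j] vanish but [S i j] does not, the value at the sum of the two basis vectors
   is [2 * S i j]. *)
have [v vSv] : exists v : 'rV_(1 + n), (v *m S *m v^T) 0 0 != 0.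
  have deltaE i j : ((delta_mx 0 i : 'rV_(1 + n)) *m S *m (delta_mx 0 j : 'rV_(1 + n))^T) 0 0 = S i j.
    by rewrite -rowE trmx_delta -colE !mxE.
  have /matrix0Pn[i [j Sij]] := S0.
  have [Sii|] := eqVneq (S i i) 0; last by exists (delta_mx 0 i); rewrite deltaE.
  have [Sjj|] := eqVneq (S j j) 0; last by exists (delta_mx 0 j); rewrite deltaE.
  have addE (A B : 'M[K]_1) : (A + B) 0 0 = A 0 0 + B 0 0 by rewrite mxE.
  exists (delta_mx 0 i + delta_mx 0 j).
  rewrite raddfD !mulmxDl !mulmxDr !addE !deltaE Sii Sjj add0r addr0 (symE j i).
  by rewrite -mulr2n -mulr_natl mulf_neq0.
have v0 : v != 0 by apply: contraNneq vSv => ->; rewrite !mul0mx mxE.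
have [c [P0 uP0 [rowP0 c0]]] := unitmx_first_row v0.
pose S' : 'M_(1 + n) := P0 *m S *m P0^T.
have symS' : S'^T = S' by rewrite /S' !trmx_mul trmxK symS mulmxA.
have [r r2] := closed_sqrt (S' 0 0).
have r0 : r != 0.
  rewrite -sqrf_eq0 r2; have -> : S' 0 0 = c * (c * (v *m S *m v^T) 0 0).
    rewrite -[LHS](_ : (row 0 P0 *m S *m (row 0 P0)^T) 0 0 = _).
      by rewrite rowP0 linearZ /= -!scalemxAl -scalemxAr !mxE.
    by rewrite tr_row -row_mul mxE [RHS]mxE; apply: eq_bigr => k _; rewrite mxE [col _ _ _ _]mxE.
  by rewrite !mulf_neq0.
pose b := dlsubmx S'.
have ub : ursubmx S' = b^T by rewrite trmx_dlsub symS'.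
have [|Q QE] := IHn (drsubmx S' - r ^- 2 *: (b *m b^T)).
  by rewrite linearB linearZ /= trmx_drsub symS' trmx_mul trmxK.
pose R := block_mx r%:M (r^-1 *: b^T) 0 Q.
have RE : S' = R^T *m R.
  rewrite -[LHS]submxK /R tr_block_mx mulmx_block !trmx0 !mulmx0 !mul0mx !addr0.
  rewrite tr_scalar_mx -scalar_mxM -expr2 r2 ub mul_scalar_mx scalerA mulfV // scale1r.
  rewrite linearZ /= trmxK mul_mx_scalar scalerA mulfV // scale1r.
  rewrite -scalemxAl -scalemxAr scalerA -QE -expr2 exprVn addrC subrK.
  by congr block_mx; rewrite [LHS]mx11_scalar !mxE !lshift0.
exists (R *m (invmx P0)^T); rewrite trmx_mul trmxK mulmxA -(mulmxA _ R^T) -RE.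
by rewrite trmx_inv /S' !mulmxA mulVmx // mul1mx -mulmxA mulmxV ?unitmx_tr // mulmx1.
Qed.

Lemma symmetric_congruent n (S S0 : 'M[K]_n) :
    S^T = S -> S0^T = S0 -> S \in unitmx -> S0 \in unitmx ->
  exists2 g, g \in unitmx & g^T *m S0 *m g = S.
Proof.
move=> /symmetric_congruent1[P ->] /symmetric_congruent1[P0 ->].
rewrite !unitmx_mul !unitmx_tr !andbb => uP uP0.
exists (invmx P0 *m P); first by rewrite unitmx_mul unitmx_inv uP0.
rewrite trmx_mul trmx_inv !mulmxA mulmxKV ?unitmx_tr // -!mulmxA.
by rewrite mulKVmx.
Qed.

End SymmetricCongruence.

(** * Pfaffians and pencils of skew forms on K^4 *)

(** Indices are written [inord k] with [k] a numeral, so that case analysis and [inordK] turn small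
    matrix identities into goals for [ring]. *)
Lemma big_ord_inord (V : nmodType) n (F : 'I_n.+1 -> V) :
  \sum_i F i = \sum_(0 <= k < n.+1) F (inord k).
Proof. by rewrite big_mkord; apply: eq_bigr => i _; rewrite inord_val. Qed.

Lemma forall_inord n (P : 'I_n.+1 -> Prop) :
  (forall k, (k < n.+1)%N -> P (inord k)) -> forall i, P i.
Proof. by move=> H i; rewrite -(inord_val i); apply: H. Qed.

Section Antidiagonal.
Variables (R : comUnitRingType) (n : nat).

(** The normal form chosen for nondegenerate symmetric matrices: a hyperbolic plane for [n = 1], the
    conic x_1^2 + 2 x_0 x_2 for [n = 2]. *)
Definition antidiag_mx : 'M[R]_n.+1 := \matrix_(i, j) ((i + j)%N == n)%:R.

Lemma tr_antidiag_mx : antidiag_mx^T = antidiag_mx.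
Proof. by apply/matrixP => i j; rewrite !mxE addnC. Qed.

Lemma antidiag_mxK : antidiag_mx *m antidiag_mx = 1%:M.
Proof.
apply/matrixP => i j; rewrite mxE (bigD1 (rev_ord i)) //= big1 ?addr0 => [|k ne_k].
  rewrite !mxE /= -val_eqE /= -natrM mulnb; congr (nat_of_bool _)%:R.
  by have := ltn_ord i; have := ltn_ord j; lia.
rewrite !mxE; case: (_ =P n) => [e|]; last by rewrite mul0r.
by case/eqP: ne_k; apply: val_inj; rewrite /=; lia.
Qed.

Lemma unitmx_antidiag : antidiag_mx \in unitmx.
Proof. by case/mulmx1_unit: antidiag_mxK. Qed.

End Antidiagonal.

Section Pfaffians.
Variable K : fieldType.

Definition entry n (A : 'M[K]_n.+1) (i j : nat) : K := A (inord i) (inord j).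

Definition skew n (A : 'M[K]_n) := forall i j, A i j = - A j i.

Lemma skew_lin n q (A : 'I_q -> 'M[K]_n) (g : 'I_q -> K) :
  (forall k, skew (A k)) -> skew (\sum_k g k *: A k).
Proof.
move=> sA i j; rewrite !summxE -sumrN; apply: eq_bigr => k _.
by rewrite !mxE -mulrN -sA.
Qed.

Lemma skew_congr n (A U : 'M[K]_n) : skew A -> skew (U^T *m A *m U).
Proof.
move=> sA i j; have sAT : A^T = - A by apply/matrixP => k l; rewrite !mxE sA.
have : (U^T *m A *m U)^T = - (U^T *m A *m U).
  by rewrite !trmx_mul trmxK sAT mulNmx mulmxN !mulmxA.
by move/matrixP/(_ j i); rewrite mxE => ->; rewrite mxE.
Qed.

Hypothesis two_neq0 : 2 != 0 :> K.

(** Rewriting with it leaves only entries above the diagonal, which [ring] treats as independent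
    variables. *)
Lemma skewE n (A : 'M[K]_n.+1) : skew A -> forall i j, A i j =
  if (i < j)%N then entry A i j else if (j < i)%N then - entry A j i else 0.
Proof.
move=> sA i j; rewrite /entry !inord_val; case: ltngtP => // /val_inj <-.
have /eqP := sA i i; rewrite -addr_eq0 -mulr2n -mulr_natl mulf_eq0 (negPf two_neq0) /=.
by move/eqP.
Qed.

(* The polarization of the Pfaffian of the submatrix on the indices w, x, y, z
   (twice the Pfaffian when a = b). *)
Definition pfq (w x y z : nat) (a b : nat -> nat -> K) : K :=
  a w x * b y z + a y z * b w x - a w y * b x z - a x z * b w y
  + a w z * b x y + a x y * b w z.

Lemma pfqC w x y z a b : pfq w x y z a b = pfq w x y z b a.
Proof. by rewrite /pfq; ring. Qed.

Lemma pfq_lin q w x y z n (A : 'I_q -> 'M[K]_n.+1) (g : 'I_q -> K) b :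
  pfq w x y z (entry (\sum_k g k *: A k)) b = \sum_k g k * pfq w x y z (entry (A k)) b.
Proof.
have E i j : entry (\sum_k g k *: A k) i j = \sum_k g k * entry (A k) i j.
  by rewrite /entry summxE; apply: eq_bigr => k _; rewrite mxE.
rewrite /pfq !E !mulr_suml -!big_split -!sumrN -!big_split; apply: eq_bigr => k _ /=.
by ring.
Qed.

Lemma gram_lin n q (beta : 'M[K]_n -> 'M[K]_n -> K) (A : 'I_q -> 'M[K]_n) (g : 'M[K]_q) :
    (forall X Y, beta X Y = beta Y X) ->
    (forall (c : 'I_q -> K) Y, beta (\sum_k c k *: A k) Y = \sum_k c k * beta (A k) Y) ->
  \matrix_(k, l) beta (\sum_j g k j *: A j) (\sum_j g l j *: A j)
  = g *m (\matrix_(k, l) beta (A k) (A l)) *m g^T.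
Proof.
move=> betaC beta_lin; apply/matrixP => i j; rewrite mxE beta_lin.
under eq_bigr do rewrite betaC beta_lin mulr_sumr.
rewrite exchange_big mxE; apply: eq_bigr => l _ /=.
rewrite mxE mxE mulr_suml; apply: eq_bigr => k _.
by rewrite mxE [in RHS]betaC mulrCA mulrC.
Qed.

Definition pf4 (A B : 'M[K]_4) : K := pfq 0 1 2 3 (entry A) (entry B).

(** The Pfaffian adjugate: for [A] skew, [A *m hat4 A] is the Pfaffian of [A] times the identity. *)
Definition hat4 (A : 'M[K]_4) : 'M[K]_4 :=
  \matrix_(i, j) match nat_of_ord i, nat_of_ord j with
  | 0, 1 => - entry A 2 3 | 0, 2 => entry A 1 3 | 0, 3 => - entry A 1 2
  | 1, 0 => entry A 2 3 | 1, 2 => - entry A 0 3 | 1, 3 => entry A 0 2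
  | 2, 0 => - entry A 1 3 | 2, 1 => entry A 0 3 | 2, 3 => - entry A 0 1
  | 3, 0 => entry A 1 2 | 3, 1 => - entry A 0 2 | 3, 2 => entry A 0 1
  | _, _ => 0
  end.

Lemma hat4_skew A : skew (hat4 A).
Proof.
apply: forall_inord => -[|[|[|[|//]]]] _; apply: forall_inord => -[|[|[|[|//]]]] _;
by rewrite !mxE !inordK // ?oppr0 ?opprK.
Qed.

Lemma mulmx_hat4 A B : skew A -> skew B ->
  A *m hat4 B + B *m hat4 A = (pf4 A B)%:M.
Proof.
move=> sA sB; apply/matrixP; apply: forall_inord => i lti; apply: forall_inord => j ltj.
rewrite !mxE -val_eqE /= !inordK // !big_ord_inord !unlock /= !mxE.
rewrite !(skewE sA) !(skewE sB) !inordK // /pf4 /pfq.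
move: i lti j ltj => [|[|[|[|//]]]] _ [|[|[|[|//]]]] _ /=; by ring.
Qed.

(* The coordinates are the 4x4 Pfaffians with alternating signs, so that
   A *m pf5 A A = 0 for A skew. *)
Definition pf5 (A B : 'M[K]_5) : 'cV[K]_5 :=
  \col_i match nat_of_ord i with
  | 0 => pfq 1 2 3 4 (entry A) (entry B) | 1 => - pfq 0 2 3 4 (entry A) (entry B)
  | 2 => pfq 0 1 3 4 (entry A) (entry B) | 3 => - pfq 0 1 2 4 (entry A) (entry B)
  | _ => pfq 0 1 2 3 (entry A) (entry B)
  end.

Lemma pf5C A B : pf5 A B = pf5 B A.
Proof. by apply/colP => i; rewrite !mxE !(pfqC _ _ _ _ (entry A)). Qed.

Lemma pf5_lin q (A : 'I_q -> 'M[K]_5) (g : 'I_q -> K) B i :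
  pf5 (\sum_k g k *: A k) B i 0 = \sum_k g k * pf5 (A k) B i 0.
Proof.
under [RHS]eq_bigr do rewrite mxE.
rewrite mxE; case: (nat_of_ord i) => [|[|[|[|?]]]]; rewrite pfq_lin // -sumrN;
by apply: eq_bigr => k _; rewrite mulrN.
Qed.

(** The full polarization of [A *m pf5 A A = 0], a polynomial identity in the entries above the
    diagonal. *)
Lemma mulmx_pf5 A B C : skew A -> skew B -> skew C ->
  A *m pf5 B C + B *m pf5 C A + C *m pf5 A B = 0.
Proof.
move=> sA sB sC; apply/colP; apply: forall_inord => i lti.
rewrite !mxE !big_ord_inord !unlock /= !mxE.
rewrite !(skewE sA) !(skewE sB) !(skewE sC) !inordK // /pfq.
by move: i lti => [|[|[|[|[|//]]]]] _ /=; ring.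
Qed.

End Pfaffians.

Section Pencils.
Variable K : closedFieldType.
Hypothesis two_neq0 : 2 != 0 :> K.

Definition wedge n (i j : nat) : 'M[K]_n.+1 :=
  \matrix_(k, l) (((k == i :> nat) && (l == j :> nat))%:R
    - ((k == j :> nat) && (l == i :> nat))%:R).

Definition pencil_gram (A : 'I_2 -> 'M[K]_4) : 'M[K]_2 := \matrix_(k, l) pf4 (A k) (A l).

Lemma pencil_gram_lin (A : 'I_2 -> 'M[K]_4) (g : 'M[K]_2) :
  pencil_gram (fun k => \sum_l g k l *: A l) = g *m pencil_gram A *m g^T.
Proof. by apply: gram_lin => [X Y | c Y]; rewrite /pf4 ?pfq_lin // pfqC. Qed.

Definition split_pencil (k : 'I_2) : 'M[K]_4 := wedge 3 (2 * k) (2 * k).+1.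

(* If two members A, B of the pencil are decomposable and pf4 A B = 1, then
   K^4 is the direct sum of their radicals, which are spanned by the columns
   of hat4 A and hat4 B. *)
Lemma net_equiv_split_pencil (A : 'I_2 -> 'M[K]_4) :
    (forall k, skew (A k)) -> pencil_gram A \in unitmx ->
  net_equiv A split_pencil.
Proof.
move=> sA uA.
have symA : (pencil_gram A)^T = pencil_gram A.
  by apply/matrixP => i j; rewrite !mxE /pf4 pfqC.
(* An antidiagonal Gram matrix means that the new members [B] and [C] have zero Pfaffian and
   [pf4 B C = 1]. *)
have [g ug gE] := symmetric_congruent two_neq0 (tr_antidiag_mx K 1) symA (unitmx_antidiag K 1) uA.
apply: net_equiv_trans (net_equiv_sym (net_equiv_lin A (_ : g^T \in unitmx))) _.
  by rewrite unitmx_tr.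
set A' := fun k => _.
have sA' k : skew (A' k) by apply: skew_lin.
have gramA' : pencil_gram A' = antidiag_mx K 1 by rewrite pencil_gram_lin trmxK.
clearbody A'; clear A sA uA symA g ug gE.
pose B := A' (inord 0); pose C := A' (inord 1).
have [sB sC] : skew B /\ skew C by split; apply: sA'.
have pfE i j : pf4 (A' i) (A' j) = ((i + j)%N == 1)%:R.
  by have := congr1 (fun M : 'M_2 => M i j) gramA'; rewrite !mxE.
have halve (M : 'M[K]_4) : M + M = 0 -> M = 0.
  move=> MM; apply/matrixP => i j; have := congr1 (fun N : 'M_4 => N i j) MM.
  rewrite !mxE => /eqP; rewrite -mulr2n -mulr_natl mulf_eq0 (negPf two_neq0) /=.
  by move/eqP.
have BB : B *m hat4 B = 0.
  by apply: halve; rewrite mulmx_hat4 // pfE !inordK //; apply/matrixP => i j; rewrite !mxE mul0rn.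
have CC : C *m hat4 C = 0.
  by apply: halve; rewrite mulmx_hat4 // pfE !inordK //; apply/matrixP => i j; rewrite !mxE mul0rn.
have BC : B *m hat4 C + C *m hat4 B = 1%:M.
  by rewrite mulmx_hat4 // pfE !inordK.
have tr_skew (M : 'M[K]_4) : skew M -> M^T = - M.
  by move=> sM; apply/matrixP => i j; rewrite !mxE sM.
(* Since [hat4 M] is skew, this makes the values of [N] on the columns of [hat4 M] equal to entries
   of [hat4 M]. *)
have hatM (M N : 'M[K]_4) : skew M -> skew N -> M *m hat4 M = 0 -> M *m hat4 N + N *m hat4 M = 1%:M ->
    hat4 M *m N *m hat4 M = hat4 M.
  move=> sM sN MM MN.
  have MM' : hat4 M *m M = 0.
    apply: trmx_inj; rewrite trmx_mul (tr_skew _ sM) (tr_skew _ (@hat4_skew K M)).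
    by rewrite mulNmx mulmxN MM !oppr0 trmx0.
  by rewrite -[RHS]mulmx1 -MN mulmxDr !mulmxA MM' mul0mx add0r.
have hat_neq0 (M N : 'M[K]_4) : M *m hat4 N + N *m hat4 M = 1%:M ->
    hat4 M *m N *m hat4 M = hat4 M -> N *m hat4 N = 0 -> hat4 M != 0.
  move=> MN MNM NN; apply/eqP => M0; have MN1 : M *m hat4 N = 1%:M.
    by rewrite -MN M0 mulmx0 addr0.
  have : (1%:M : 'M[K]_4) = 0.
    have N0 : N = 0.
      have /mulmx1C NM := MN1.
      by rewrite -[N]mulmx1 -NM mulmxA NN mul0mx.
    rewrite -MN1 N0; have -> : hat4 (0 : 'M[K]_4) = 0; last by rewrite mulmx0.
    apply/matrixP => i j; rewrite !mxE /entry.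
    by case: (nat_of_ord i) => [|[|[|[|?]]]]; case: (nat_of_ord j) => [|[|[|[|?]]]];
       rewrite ?mxE ?oppr0.
  by move/matrixP/(_ 0 0); rewrite !mxE eqxx => /eqP; rewrite oner_eq0.
have CB : C *m hat4 B + B *m hat4 C = 1%:M by rewrite addrC.
have hBE := hatM _ _ sB sC BB BC; have hCE := hatM _ _ sC sB CC CB.
(* A nonzero entry selects two columns of [hat4 B] on which [C] is nondegenerate, and likewise for
   [hat4 C] and [B]. *)
have /matrix0Pn[i [j Bij]] := hat_neq0 _ _ BC hBE CC.
have /matrix0Pn[k [l Ckl]] := hat_neq0 _ _ CB hCE BB.
pose b r : 'cV[K]_4 := hat4 B *m delta_mx r 0.
pose c r : 'cV[K]_4 := hat4 C *m delta_mx r 0.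
(* [B] kills the [b] columns and [C] the [c] columns, so in this basis [B] is a multiple of e0 ^ e1
   and [C] of e2 ^ e3. *)
pose U : 'M[K]_4 := \matrix_(x, y)
  match nat_of_ord y with 0 => c k x 0 | 1 => c l x 0 | 2 => b i x 0 | _ => b j x 0 end.
have colU y : (y < 4)%N -> col (inord y) U =
    match y with 0 => c k | 1 => c l | 2 => b i | _ => b j end.
  move=> lty; apply/colP => x; rewrite [LHS]mxE [LHS]mxE inordK //.
  by case: y lty => [|[|[|[|]]]].
have UE (M : 'M[K]_4) x y : (U^T *m M *m U) x y = ((col x U)^T *m M *m col y U) 0 0.
  by rewrite tr_col -row_mul mxE [RHS]mxE; apply: eq_bigr => r _; rewrite [row _ _ _ _]mxE [col _ _ _ _]mxE.
have Bb r : B *m b r = 0 by rewrite mulmxA BB mul0mx.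
have Cc r : C *m c r = 0 by rewrite mulmxA CC mul0mx.
have dual (M : 'M[K]_4) r N : skew M -> M *m (N *m delta_mx r 0 : 'cV[K]_4) = 0 ->
    (N *m delta_mx r 0 : 'cV[K]_4)^T *m M = 0.
  by move=> sM M0; apply: trmx_inj; rewrite trmx_mul trmxK (tr_skew _ sM) mulNmx M0 oppr0 trmx0.
have bB r : (b r)^T *m B = 0 by apply: dual => //; apply: Bb.
have cC r : (c r)^T *m C = 0 by apply: dual => //; apply: Cc.
have bilE (M N : 'M[K]_4) x y : hat4 M *m N *m hat4 M = hat4 M ->
    ((hat4 M *m delta_mx x 0 : 'cV[K]_4)^T *m N *m (hat4 M *m delta_mx y 0 : 'cV[K]_4)) 0 0
    = hat4 M y x.
  move=> MN; rewrite trmx_mul (tr_skew _ (@hat4_skew K M)) mulmxN !mulNmx !mulmxA.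
  rewrite -2!(mulmxA (delta_mx x 0)^T) MN trmx_delta -rowE -colE.
  by rewrite 3!mxE -hat4_skew.
have cBc x y : ((c x)^T *m B *m c y) 0 0 = hat4 C y x by apply: bilE.
have bCb x y : ((b x)^T *m C *m b y) 0 0 = hat4 B y x by apply: bilE.
clearbody b c.
have hat_diag (M : 'M[K]_4) x : hat4 M x x = 0 :> K.
  by rewrite (skewE two_neq0 (@hat4_skew K M)) ltnn.
have mx00 : (0 : 'M[K]_1) 0 0 = 0 by rewrite mxE.
have splitE a r x y : (r < 2)%N -> (x < 4)%N -> (y < 4)%N ->
    (a *: split_pencil (inord r)) (inord x) (inord y)
    = a * (((x == 2 * r) && (y == (2 * r).+1))%:R
           - ((x == (2 * r).+1) && (y == 2 * r))%:R).
  by move=> ltr ltx lty; rewrite !mxE !inordK.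
have UB : U^T *m B *m U = hat4 C l k *: split_pencil (inord 0).
  apply/matrixP; apply: forall_inord => x ltx; apply: forall_inord => y lty.
  rewrite UE !colU // splitE // ?muln0 ?muln1 /=.
  case: x ltx => [|[|[|[|//]]]] _; case: y lty => [|[|[|[|//]]]] _ /=;
  by rewrite ?bB ?mul0mx -?mulmxA ?Bb ?mulmx0 ?mulmxA ?cBc ?hat_diag ?mx00
       ?subrr ?mulr0 ?subr0 ?sub0r ?mulr1 // mulrN1 -hat4_skew.
have UC : U^T *m C *m U = hat4 B j i *: split_pencil (inord 1).
  apply/matrixP; apply: forall_inord => x ltx; apply: forall_inord => y lty.
  rewrite UE !colU // splitE // ?muln0 ?muln1 /=.
  case: x ltx => [|[|[|[|//]]]] _; case: y lty => [|[|[|[|//]]]] _ /=;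
  by rewrite ?cC ?mul0mx -?mulmxA ?Cc ?mulmx0 ?mulmxA ?bCb ?hat_diag ?mx00
       ?subrr ?mulr0 ?subr0 ?sub0r ?mulr1 // mulrN1 -hat4_skew.
(* [B + C] becomes block diagonal with two nonzero skew 2 x 2 blocks, which is invertible only if
   [U] is. *)
have uU : U \in unitmx.
  have : U^T *m (B + C) *m U \in unitmx; last by rewrite !unitmx_mul; case/andP.
  have Clk : hat4 C l k != 0 by rewrite hat4_skew oppr_eq0.
  have Bji : hat4 B j i != 0 by rewrite hat4_skew oppr_eq0.
  rewrite mulmxDr mulmxDl UB UC.
  move: (hat4 C l k) (hat4 B j i) Clk Bji => a1 a2 a1_0 a2_0; apply: unitmx_inj => X XE.
  have coord x : ((a1 *: split_pencil (inord 0) + a2 *: split_pencil (inord 1)) *m X) x 0 = 0.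
    by rewrite XE mxE.
  apply/colP; apply: forall_inord => x ltx; rewrite [RHS]mxE.
  have := (coord (inord 0), coord (inord 1), coord (inord 2), coord (inord 3)).
  rewrite !mxE !big_ord_inord unlock /= !mxE !inordK //=.
  rewrite !(subr0, subrr, mulr0, mul0r, addr0, add0r, mulr1, sub0r, mulrN1, mulNr).
  case=> [[[/eqP e0 /eqP e1] /eqP e2] /eqP e3].
  move: e0 e1 e2 e3; rewrite !oppr_eq0 !mulf_eq0 (negPf a1_0) (negPf a2_0) /=.
  by case: x ltx => [|[|[|[|//]]]] _ /eqP ? /eqP ? /eqP ? /eqP ?.
pose d : 'rV[K]_2 := \row_r if nat_of_ord r is 0 then hat4 C l k else hat4 B j i.
have dE r : (r < 2)%N -> d 0 (inord r) = if r is 0 then hat4 C l k else hat4 B j i.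
  by move=> ltr; rewrite mxE inordK.
exists U, (diag_mx d); split => //.
  rewrite unitmxE det_diag unitfE; apply/prodf_neq0 => r _; rewrite mxE.
  by case: (nat_of_ord r) => [|?]; rewrite hat4_skew oppr_eq0.
apply: forall_inord => r ltr; rewrite (bigD1 (inord r)) //= big1 => [|s /negPf ne_sr].
  rewrite [diag_mx _ _ _]mxE eqxx mulr1n addr0 dE //.
  by case: r ltr => [|[|//]] _; rewrite -?UB -?UC.
by rewrite [diag_mx _ _ _]mxE eq_sym ne_sr scale0r.
Qed.

End Pencils.

(** * Nets of skew forms on K^5 *)

Section Nets5.
Variable K : closedFieldType.
Hypothesis charK0 : [pchar K] =i pred0.

Let natK_neq0 k : (0 < k)%N -> k%:R != 0 :> K.
Proof. by move: charK0 => /pcharf0P ->; rewrite lt0n. Qed.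

Let nz k (x : K) : (0 < k)%N -> k%:R * x = 0 -> x = 0.
Proof. by move=> /natK_neq0 k0 /eqP; rewrite mulf_eq0 (negPf k0) => /eqP. Qed.

(* In the basis P_00, P_01, P_02, P_12, P_22, indexed by a + b, the vector
   P_ab is scale22 a b times the basis vector of index a + b. *)
Definition scale22 (a b : nat) : K := match a, b with 1, 1 => -2 | _, _ => 1 end.

(** The candidate singled out by [cyclic_relation_unique], normalized by entry (1, 2) of the last
    form being 1. Form [k] is supported on index pairs of sum 5 - k. *)
Definition conic_net (k : nat) : 'M[K]_5 := match k with
  | 0 => wedge K 4 2 3 - 2 *: wedge K 4 1 4
  | 1 => wedge K 4 1 3 + 4 *: wedge K 4 0 4
  | _ => wedge K 4 1 2 - 2 *: wedge K 4 0 3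
  end.

(** A linear system in the 30 entries above the diagonal, solved in triangular order: each instance
    isolates one unknown with a coefficient invertible in characteristic 0. The 24 facts [z...] are
    the vanishing entries, the facts [w...] the multiples of [B 2 1 2]. *)
Lemma cyclic_relation_unique (B : nat -> nat -> nat -> K) :
    (forall a x y, B a x y = - B a y x) ->
    (forall a b c x, (a < 3)%N -> (b < 3)%N -> (c < 3)%N -> (x < 5)%N ->
       scale22 b c * B a x (b + c)%N + scale22 c a * B b x (c + a)%N
       + scale22 a b * B c x (a + b)%N = 0) ->
  forall a x y, (a < 3)%N -> (x < 5)%N -> (y < 5)%N ->
    B a x y = B 2 1 2 * conic_net a (inord x) (inord y).
Proof.
move=> skewB E.
have diagB a x : B a x x = 0.
  by apply: (nz (k := 2)) => //; rewrite mulr_natl mulr2n {2}skewB subrr.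
have sk := (diagB, fun a => skewB a 1 0, fun a => skewB a 2 0, fun a => skewB a 3 0,
  fun a => skewB a 4 0, fun a => skewB a 2 1, fun a => skewB a 3 1,
  fun a => skewB a 4 1, fun a => skewB a 3 2, fun a => skewB a 4 2,
  fun a => skewB a 4 3).
have z001 : B 0 0 1 = 0.
  have := E 0 0 0 1 isT isT isT isT; rewrite /scale22 /= ?(addSn, add0n) ?sk  => e.
  by apply: (nz (k := 3)) => //; rewrite -[RHS]oppr0 -e; ring.
have z002 : B 0 0 2 = 0.
  have := E 0 0 0 2 isT isT isT isT; rewrite /scale22 /= ?(addSn, add0n) ?sk  => e.
  by apply: (nz (k := 3)) => //; rewrite -[RHS]oppr0 -e; ring.
have z003 : B 0 0 3 = 0.
  have := E 0 0 0 3 isT isT isT isT; rewrite /scale22 /= ?(addSn, add0n) ?sk  => e.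
  by apply: (nz (k := 3)) => //; rewrite -[RHS]oppr0 -e; ring.
have z004 : B 0 0 4 = 0.
  have := E 0 0 0 4 isT isT isT isT; rewrite /scale22 /= ?(addSn, add0n) ?sk  => e.
  by apply: (nz (k := 3)) => //; rewrite -[RHS]oppr0 -e; ring.
have z101 : B 1 0 1 = 0.
  have := E 0 0 1 1 isT isT isT isT; rewrite /scale22 /= ?(addSn, add0n) ?sk  => e.
  by apply: (nz (k := 1)) => //; rewrite -[RHS]oppr0 -e; ring.
have z202 : B 2 0 2 = 0.
  have := E 0 0 2 2 isT isT isT isT; rewrite /scale22 /= ?(addSn, add0n) ?sk  => e.
  by apply: (nz (k := 1)) => //; rewrite -[RHS]oppr0 -e; ring.
have z012 : B 0 1 2 = 0.
  have := E 0 1 1 1 isT isT isT isT; rewrite /scale22 /= ?(addSn, add0n) ?sk  => e.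
  by apply: (nz (k := 2)) => //; rewrite -[RHS]oppr0 -e; ring.
have z112 : B 1 1 2 = 0.
  have := E 0 1 1 2 isT isT isT isT; rewrite /scale22 /= ?(addSn, add0n) ?sk  => e.
  by apply: (nz (k := 2)) => //; rewrite -[RHS]oppr0 -e; ring.
have z013 : B 0 1 3 = 0.
  have := E 0 1 2 1 isT isT isT isT; rewrite /scale22 /= ?(addSn, add0n) ?sk z112 => e.
  by apply: (nz (k := 1)) => //; rewrite -e; ring.
have z024 : B 0 2 4 = 0.
  have := E 0 2 2 2 isT isT isT isT; rewrite /scale22 /= ?(addSn, add0n) ?sk  => e.
  by apply: (nz (k := 1)) => //; rewrite -e; ring.
have z224 : B 2 2 4 = 0.
  have := E 0 2 2 4 isT isT isT isT; rewrite /scale22 /= ?(addSn, add0n) ?sk  => e.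
  by apply: (nz (k := 2)) => //; rewrite -[RHS]oppr0 -e; ring.
have z102 : B 1 0 2 = 0.
  have := E 1 1 1 0 isT isT isT isT; rewrite /scale22 /= ?(addSn, add0n) ?sk  => e.
  by apply: (nz (k := 6)) => //; rewrite -[RHS]oppr0 -e; ring.
have z123 : B 1 2 3 = 0.
  have := E 1 1 1 3 isT isT isT isT; rewrite /scale22 /= ?(addSn, add0n) ?sk  => e.
  by apply: (nz (k := 6)) => //; rewrite -e; ring.
have z124 : B 1 2 4 = 0.
  have := E 1 1 1 4 isT isT isT isT; rewrite /scale22 /= ?(addSn, add0n) ?sk  => e.
  by apply: (nz (k := 6)) => //; rewrite -e; ring.
have z103 : B 1 0 3 = 0.
  have := E 1 1 2 0 isT isT isT isT; rewrite /scale22 /= ?(addSn, add0n) ?sk z202 => e.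
  by apply: (nz (k := 2)) => //; rewrite -e; ring.
have z223 : B 2 2 3 = 0.
  have := E 1 1 2 3 isT isT isT isT; rewrite /scale22 /= ?(addSn, add0n) ?sk  => e.
  by apply: (nz (k := 2)) => //; rewrite -e; ring.
have z134 : B 1 3 4 = 0.
  have := E 1 1 2 4 isT isT isT isT; rewrite /scale22 /= ?(addSn, add0n) ?sk z224 => e.
  by apply: (nz (k := 2)) => //; rewrite -[RHS]oppr0 -e; ring.
have z234 : B 2 3 4 = 0.
  have := E 1 2 2 4 isT isT isT isT; rewrite /scale22 /= ?(addSn, add0n) ?sk  => e.
  by apply: (nz (k := 2)) => //; rewrite -[RHS]oppr0 -e; ring.
have z204 : B 2 0 4 = 0.
  have := E 2 2 2 0 isT isT isT isT; rewrite /scale22 /= ?(addSn, add0n) ?sk  => e.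
  by apply: (nz (k := 3)) => //; rewrite -e; ring.
have z214 : B 2 1 4 = 0.
  have := E 2 2 2 1 isT isT isT isT; rewrite /scale22 /= ?(addSn, add0n) ?sk  => e.
  by apply: (nz (k := 3)) => //; rewrite -e; ring.
have z201 : B 2 0 1 = 0.
  have := E 0 0 2 1 isT isT isT isT; rewrite /scale22 /= ?(addSn, add0n) ?sk z012 => e.
  by apply: (nz (k := 1)) => //; rewrite -[RHS]oppr0 -e; ring.
have z114 : B 1 1 4 = 0.
  have := E 0 1 1 4 isT isT isT isT; rewrite /scale22 /= ?(addSn, add0n) ?sk z024 => e.
  by apply: (nz (k := 2)) => //; rewrite -[RHS]oppr0 -e; ring.
have z213 : B 2 1 3 = 0.
  have := E 0 1 2 3 isT isT isT isT; rewrite /scale22 /= ?(addSn, add0n) ?sk z123 => e.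
  by apply: (nz (k := 1)) => //; rewrite -[RHS]oppr0 -e; ring.
have z034 : B 0 3 4 = 0.
  have := E 0 1 2 4 isT isT isT isT; rewrite /scale22 /= ?(addSn, add0n) ?sk z124 z214 => e.
  by apply: (nz (k := 1)) => //; rewrite -[RHS]oppr0 -e; ring.
have w123 : B 0 2 3 = B 2 1 2.
  have := E 0 1 2 2 isT isT isT isT; rewrite /scale22 /= ?(addSn, add0n) ?sk => e.
  by apply/eqP; rewrite -subr_eq0 -e; apply/eqP; ring.
have w213 : B 1 1 3 = B 2 1 2.
  have := E 1 1 2 1 isT isT isT isT; rewrite /scale22 /= ?(addSn, add0n) ?sk => e.
  by apply/eqP; rewrite -subr_eq0; apply/eqP; apply: (nz (k := 2)) => //; rewrite -e; ring.
have w114 : B 0 1 4 = - 2 * B 2 1 2.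
  have := E 0 2 2 1 isT isT isT isT; rewrite /scale22 /= ?(addSn, add0n) ?sk => e.
  by apply/eqP; rewrite -subr_eq0 -e; apply/eqP; ring.
have w303 : B 2 0 3 = - 2 * B 2 1 2.
  have := E 0 0 2 3 isT isT isT isT; rewrite /scale22 /= ?(addSn, add0n) ?sk w123 => e.
  by apply/eqP; rewrite -subr_eq0 -oppr_eq0 -e; apply/eqP; ring.
have w204 : B 1 0 4 = 4 * B 2 1 2.
  have := E 1 2 2 0 isT isT isT isT; rewrite /scale22 /= ?(addSn, add0n) ?sk w303 => e.
  by apply/eqP; rewrite -subr_eq0 -e; apply/eqP; ring.
move=> a x y lta ltx lty.
case: a lta => [|[|[|//]]] _; case: x ltx => [|[|[|[|[|//]]]]] _;
  case: y lty => [|[|[|[|[|//]]]]] _; rewrite !mxE !inordK //= ?sk;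
  rewrite ?z001 ?z002 ?z003 ?z004 ?z101 ?z202 ?z012 ?z112 ?z013 ?z024 ?z224 ?z102
    ?z123 ?z124 ?z103 ?z223 ?z134 ?z234 ?z204 ?z214 ?z201 ?z114 ?z213 ?z034
    ?w123 ?w213 ?w114 ?w303 ?w204; ring.
Qed.

End Nets5.
Section Conics.
Variable K : closedFieldType.
Hypothesis charK0 : [pchar K] =i pred0.

Let two_neq0 : 2 != 0 :> K.
Proof. by move: charK0 => /pcharf0P ->. Qed.

Definition pf5_gram (A : 'I_3 -> 'M[K]_5) (i : 'I_5) : 'M[K]_3 :=
  \matrix_(k, l) pf5 (A k) (A l) i 0.

Lemma pf5_gram_lin (A : 'I_3 -> 'M[K]_5) (g : 'M[K]_3) i :
  pf5_gram (fun k => \sum_l g k l *: A l) i = g *m pf5_gram A i *m g^T.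
Proof.
by apply: (gram_lin (beta := fun X Y => pf5 X Y i 0)) => [X Y | c Y]; rewrite ?pf5_lin // pf5C.
Qed.

(* The vectors pf5 (A k) (A l) span K^5. *)
Definition pf5_spanning (A : 'I_3 -> 'M[K]_5) :=
  forall y : 'rV[K]_5, \sum_i y 0 i *: pf5_gram A i = 0 -> y = 0.

(* The five vectors U_(k + l) = pf5 (A k) (A l), (k, l) <> (1, 1), form a
   basis, in which the cyclic relation determines the net up to a scalar. *)
Lemma net_equiv_conic_normal (A : 'I_3 -> 'M[K]_5) :
    (forall k, skew (A k)) -> pf5_spanning A ->
    pf5 (A (inord 1)) (A (inord 1)) = - 2 *: pf5 (A (inord 0)) (A (inord 2)) ->
  net_equiv A (fun k => conic_net K k).
Proof.
move=> sA spanA P11; pose P a b := pf5 (A (inord a)) (A (inord b)).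
pose U : 'M[K]_5 := \matrix_(x, y) match nat_of_ord y with
  | 0 => P 0 0 x 0 | 1 => P 0 1 x 0 | 2 => P 0 2 x 0 | 3 => P 1 2 x 0 | _ => P 2 2 x 0 end.
have PE a b : (a < 3)%N -> (b < 3)%N -> P a b = U *m (scale22 K a b *: delta_mx (inord (a + b)) 0).
  move=> lta ltb; rewrite -scalemxAr -colE; apply/colP => x.
  rewrite [RHS]mxE [col _ _ _ _]mxE [U _ _]mxE inordK; last by lia.
  case: a lta => [|[|[|//]]] _; case: b ltb => [|[|[|//]]] _ /=; rewrite ?mul1r //;
  by rewrite ?[P 1 0]pf5C ?[P 2 0]pf5C ?[P 2 1]pf5C // [P 1 1]P11 mxE.
(* A row vector killing the columns of [U] kills all six vectors, since P_11 is a multiple of P_02;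
   spanning then makes it zero. *)
have uU : U \in unitmx.
  rewrite -row_free_unit; apply: inj_row_free => y yU; apply: spanA.
  apply/matrixP; apply: forall_inord => a lta; apply: forall_inord => b ltb.
  rewrite summxE [RHS]mxE; transitivity ((y *m P a b) 0 0).
    by rewrite [RHS]mxE; apply: eq_bigr => i _; rewrite !mxE.
  by rewrite PE // mulmxA yU mul0mx mxE.
pose B a : 'M[K]_5 := U^T *m A (inord a) *m U.
have sB a : skew (B a) by apply/skew_congr/sA.
have cyc a b c : (a < 3)%N -> (b < 3)%N -> (c < 3)%N ->
    scale22 K b c *: col (inord (b + c)) (B a) + scale22 K c a *: col (inord (c + a)) (B b)
    + scale22 K a b *: col (inord (a + b)) (B c) = 0.
  move=> lta ltb ltc; have := mulmx_pf5 two_neq0 (sA (inord a)) (sA (inord b)) (sA (inord c)).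
  rewrite -/(P b c) -/(P c a) -/(P a b) !PE // => /(congr1 (mulmx U^T)).
  by rewrite mulmx0 !mulmxDr !mulmxA -!scalemxAr -!colE.
have colD (v w : 'cV[K]_5) i : (v + w) i 0 = v i 0 + w i 0 by rewrite mxE.
have colZ t (M : 'M[K]_5) i j : (t *: col j M) i 0 = t * M i j by rewrite !mxE.
pose lam := B 2 (inord 1) (inord 2).
have BE a : (a < 3)%N -> B a = lam *: conic_net K a.
  move=> lta; apply/matrixP; apply: forall_inord => x ltx; apply: forall_inord => y lty.
  rewrite [RHS]mxE; apply: (cyclic_relation_unique charK0 (B := fun a x y => B a (inord x) (inord y))) => //.
    by move=> b z t; apply: sB.
  move=> b c d z ltb ltc ltd ltz.
  have /(congr1 (fun M : 'cV_5 => M (inord z) 0)) := cyc b c d ltb ltc ltd.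
  by rewrite !colD !colZ [in RHS]mxE.
(* For [lam = 0] the whole net would vanish, and its Pfaffian vectors could not span. *)
have lam0 : lam != 0.
  apply/eqP => lam0; have A0 k : A k = 0.
    have := congr1 (fun M => invmx U^T *m M *m invmx U) (BE k (ltn_ord k)).
    rewrite /B inord_val lam0 scale0r mulmx0 mul0mx -!mulmxA mulmxV // mulmx1.
    by rewrite mulKmx ?unitmx_tr.
  have /rowP/(_ 0) : delta_mx 0 0 = 0 :> 'rV[K]_5.
    apply: spanA; apply: big1 => i _; rewrite (_ : pf5_gram A i = 0) ?scaler0 //.
    apply/matrixP => k l; rewrite !mxE !A0.
    case: (nat_of_ord i) => [|[|[|[|?]]]]; rewrite /pfq /entry !mxE; ring.
  by rewrite !mxE !eqxx => /eqP; rewrite oner_eq0.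
exists U, lam%:M; split=> //.
  by rewrite unitmxE det_scalar unitrX // unitfE.
move=> k; rewrite (bigD1 k) //= big1 => [|l /negPf ne_lk].
  by rewrite mxE eqxx mulr1n addr0 -BE // /B inord_val.
by rewrite mxE eq_sym ne_lk mulr0n scale0r.
Qed.

(** The trace condition is the relation with coefficients [c k l] between the vectors P_kl.
    Recombining the net by [g] replaces [c] by the antidiagonal matrix, and the relation becomes
    P_11 = -2 P_02. *)
Lemma net_equiv_conic (A : 'I_3 -> 'M[K]_5) (c : 'M[K]_3) :
    (forall k, skew (A k)) -> pf5_spanning A ->
    c^T = c -> c \in unitmx -> (forall i, \tr (c *m pf5_gram A i) = 0) ->
  net_equiv A (fun k => conic_net K k).
Proof.
move=> sA spanA symc uc rel.
have [g ug gE] := symmetric_congruent two_neq0 symc (tr_antidiag_mx K 2) uc (unitmx_antidiag K 2).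
apply: net_equiv_trans (net_equiv_sym (net_equiv_lin A ug)) _.
apply: net_equiv_conic_normal => [k | y y0 |]; first exact: skew_lin.
  apply: spanA; have {y0} : g *m (\sum_i y 0 i *: pf5_gram A i) *m g^T = 0.
    rewrite mulmx_sumr mulmx_suml -[RHS]y0; apply: eq_bigr => i _.
    by rewrite pf5_gram_lin -scalemxAr -scalemxAl.
  move/(congr1 (fun M => invmx g *m M *m invmx g^T)).
  by rewrite mulmx0 mul0mx -!mulmxA mulmxV ?unitmx_tr // mulmx1 mulKmx.
pose A' k : 'M[K]_5 := \sum_l g k l *: A l.
change (pf5 (A' (inord 1)) (A' (inord 1)) = - 2 *: pf5 (A' (inord 0)) (A' (inord 2))).
apply/colP => i; rewrite [RHS]mxE.
have : \tr (antidiag_mx K 2 *m pf5_gram A' i) = 0.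
  by rewrite pf5_gram_lin !mulmxA mxtrace_mulC !mulmxA gE rel.
rewrite /mxtrace big_ord_inord unlock /= ![(_ *m _) _ _]mxE !big_ord_inord unlock /=.
rewrite ![antidiag_mx _ _ _ _]mxE ![pf5_gram _ _ _ _]mxE !inordK //= [pf5 (A' (inord 2)) _]pf5C => e.
by apply/eqP; rewrite -subr_eq0 -e; apply/eqP; ring.
Qed.

End Conics.

(** * Characteristic sequences *)

Section BasisSplitting.
Variables (K : fieldType) (r : nat).
Local Notation n := (2 * r.+1)%N.

(* V is spanned by X_1, X_2, X_4, ..., X_2p and W by X_3, X_5, ..., X_(2p-1),
   with p = r.+1 and with indices shifted by one. *)
Definition split_index (x : 'I_r.+2 + 'I_r) : nat :=
  match x with inl i => (2 * i).-1 | inr k => (2 * k).+2 end.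

Lemma split_index_lt x : (split_index x < n)%N.
Proof. by case: x => i /=; have := ltn_ord i; lia. Qed.

Definition vw_index x : 'I_n := Ordinal (split_index_lt x).

(** Shifted indices of V are 0 and the odd numbers. The last [inl ord0] is a default never reached,
    as a positive even [y] has [y./2.-1] below [r]. *)
Definition vw_split (y : 'I_n) : 'I_r.+2 + 'I_r :=
  if odd y || (y == 0 :> nat) then inl (inord (uphalf y))
  else if insub y./2.-1 is Some k then inr k else inl ord0.

Lemma vw_indexK : cancel vw_index vw_split.
Proof.
case=> [i | k]; rewrite /vw_split /=.
  have -> : odd (2 * i).-1 || ((2 * i).-1 == 0)%N.
    by case: (nat_of_ord i) => // j; rewrite mul2n doubleS /= odd_double.
  congr inl; apply: val_inj; rewrite /= inordK; last by have := ltn_ord i; lia.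
  by lia.
rewrite negbK mul2n odd_double /= doubleK; case: insubP => [l _ /= e | ].
  by congr inr; apply: val_inj.
by rewrite ltn_ord.
Qed.

Lemma vw_splitK : cancel vw_split vw_index.
Proof.
move=> y; apply: val_inj; rewrite /vw_split; have := ltn_ord y; case: ifP => [yV | yV] lty /=.
  rewrite inordK; last by lia.
  by case/orP: yV => [oy | /eqP ->] //; lia.
by case: insubP => [k _ /= -> | ] ; lia.
Qed.

Lemma vw_indexP (P : 'I_n -> Prop) :
  (forall i, P (vw_index (inl i))) -> (forall k, P (vw_index (inr k))) -> forall x, P x.
Proof. by move=> Pl Pr x; rewrite -(vw_splitK x); case: (vw_split x). Qed.

(** W is central and contains all brackets, so that the bracket can be recovered from its net. *)
Definition graded (mu : bilin K n) :=
  [/\ forall x k, mu (x, vw_index (inr k)) = 0,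
      forall x y i, mu (x, y) (vw_index (inl i)) 0 = 0 &
      forall x y, mu (x, y) = - mu (y, x)].

Local Notation net := (net_of vw_index).
Local Notation bilin_of := (bilin_of_net vw_index vw_split).

Lemma graded_bilin_of_net mu : graded mu -> mu = bilin_of (net mu).
Proof.
move=> [muW muV skew]; apply/ffunP => -[x y]; rewrite ffunE /=.
rewrite -{1}(vw_splitK x) -{1}(vw_splitK y).
case: (vw_split x) => [i | k]; last by rewrite skew muW oppr0.
case: (vw_split y) => [j | k]; last by rewrite muW.
apply: (col_split_eq vw_splitK) => k.
  rewrite muV summxE big1 // => l _.
  by rewrite !mxE (h_eq vw_indexK) mulr0.
rewrite summxE (bigD1 k) //= big1 ?addr0 => [|l /negPf ne_lk].
  by rewrite !mxE !eqxx mulr1.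
by rewrite mxE [delta_mx _ _ _ _]mxE (h_eq vw_indexK) (inj_eq (@inr_inj _ _)) eq_sym ne_lk mulr0.
Qed.

Lemma graded_net_skew mu k : graded mu -> skew (net mu k).
Proof. by case=> _ _ sk i j; rewrite !mxE sk mxE. Qed.

Lemma graded0 : graded 0.
Proof. by split=> *; rewrite !ffunE ?mxE ?oppr0. Qed.

Lemma gradedD mu nu : graded mu -> graded nu -> graded (mu + nu).
Proof.
move=> [muW muV mus] [nuW nuV nus]; split=> *; rewrite !ffunE.
- by rewrite muW nuW addr0.
- by rewrite mxE muV nuV addr0.
- by rewrite mus nus opprD.
Qed.

Lemma graded_sum (I : Type) (s : seq I) (P : pred I) (F : I -> bilin K n) :
  (forall i, P i -> graded (F i)) -> graded (\sum_(i <- s | P i) F i).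
Proof. by move=> gF; elim/big_ind: _ => //; [apply: graded0 | apply: gradedD]. Qed.

Lemma graded_elem (a b : nat) (v : 'cV[K]_n) :
    (a == 1%N) || ~~ odd a -> (b == 1%N) || ~~ odd b ->
    (forall i, v (vw_index (inl i)) 0 = 0) ->
  graded (elem_bracket a b v).
Proof.
have noW a' k : (a' == 1%N) || ~~ odd a' -> ((vw_index (inr k)).+1 == a') = false.
  by move=> aV; apply/negP => /eqP /= e; move: aV; rewrite -e; lia.
move=> aV bV v0; split=> [x k | x y i | x y]; rewrite !ffunE.
- by rewrite /= noW // noW // !andbF subrr scale0r.
- by rewrite mxE v0 mulr0.
- by rewrite -scaleNr opprB /= ![(y.+1 == _) && _]andbC.
Qed.

Lemma basis_vec_W (k : nat) i : (0 < k)%N -> basis_vec K n (2 * k + 1) (vw_index (inl i)) 0 = 0.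
Proof.
move=> k0; rewrite mxE /=; case: eqP => // e; move: e (ltn_ord i).
by case: (nat_of_ord i) => [|j] /=; lia.
Qed.

Lemma graded_mu0_phi a : graded (mu0 K r.+1 + phi r.+1 a).
Proof.
apply: gradedD.
  rewrite /mu0 big_nat; apply: graded_sum => i /andP[i0 _].
  apply: graded_elem => // [|j]; first by rewrite mul2n odd_double orbT.
  exact: basis_vec_W.
apply: graded_sum => i _; apply: graded_sum => j _.
apply: graded_elem => [||l]; try by rewrite mul2n odd_double orbT.
rewrite summxE big_nat big1 // => k /andP[k0 _].
by rewrite mxE basis_vec_W ?mulr0.
Qed.

End BasisSplitting.

Section JordanSequences.

Lemma reshape_index_cons m s i :
  reshape_index (m :: s) i = if (i < m)%N then 0%N else (reshape_index s (i - m)).+1.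
Proof.
rewrite /reshape_index /= subn_eq0; case: ltnP => // le_mi.
by rewrite subSn.
Qed.

Lemma reshape_index_nseq2 r s i : reshape_index (nseq r 2%N ++ s) i =
  if (i < 2 * r)%N then i./2 else (r + reshape_index s (i - 2 * r))%N.
Proof.
elim: r i => [|r IHr] i; first by rewrite /= subn0.
rewrite reshape_index_cons IHr.
case: (ltnP i 2) => [lt2i|le2i]; first by case: ltnP => ?; lia.
have -> : (i - 2 < 2 * r)%N = (i < 2 * r.+1)%N by lia.
case: ltnP => [_|le_i]; first by lia.
by have -> : (i - 2 - 2 * r = i - 2 * r.+1)%N by lia.
Qed.

Lemma sorted_geq_12 s : sorted geq s -> 0%N \notin s -> (head 0 s <= 2)%N ->
  exists c d, s = nseq c 2%N ++ nseq d 1%N.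
Proof.
elim: s => [|x s IHs]; first by exists 0%N, 0%N.
rewrite /= inE negb_or eq_sym -lt0n => sorted_s /andP[x0 s0] x2.
have sx : (head 0 s <= x)%N by case: s sorted_s {IHs s0} => //= y s /andP[].
have [c [d sE]] := IHs (path_sorted sorted_s) s0 (leq_trans sx x2).
case: x x0 x2 sorted_s sx => [|[|[|//]]] // _ _ sorted_s sx; last first.
  by exists c.+1, d; rewrite sE.
case: c sE sx => [|c] -> // _.
by exists 0%N, d.+1.
Qed.

(** With equal sums, the sequence with fewer 2s first differs by a 1 in place of a 2. *)
Lemma lexi_nseq c d r : (c <= r)%N -> (2 * c + d = 2 * r.+1)%N ->
  ((nseq c 2%N ++ nseq d 1%N : seqlexi nat) <= (nseq r 2%N ++ [:: 1%N; 1%N] : seqlexi nat))%O.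
Proof.
elim: c r => [|c IHc] [|r] //= le_cr e.
- by have -> : d = 2%N by lia.
- by have -> : d = d.-1.+1 by lia.
rewrite Order.SeqLexiOrder.Exports.lexi_cons Order.POrderTheory.lexx /=; apply: IHc => //; lia.
Qed.

End JordanSequences.

Section CharacteristicSequence.
Variables (K : fieldType) (r : nat).
Local Notation n := (2 * r.+1)%N.
Local Notation vwi := (@vw_index r).
Local Notation bilin_of := (bilin_of_net vwi (@vw_split r)).

Lemma ad_mulmx (mu : bilin K n) X Y : ad mu X *m Y = bracket mu X Y.
Proof.
rewrite [Y in bracket _ _ Y]col_sum_delta bracket_sumr.
apply/colP => i; rewrite mxE summxE; apply: eq_bigr => j _.
by rewrite mxE bracketZr mxE mulrC.
Qed.

Lemma jordan_nilp_nseq i j : jordan_nilp K n (nseq r 2%N ++ [:: 1%N; 1%N]) i j =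
  (~~ odd i && (i < 2 * r)%N && (j == i.+1 :> nat))%:R.
Proof.
rewrite mxE; congr (nat_of_bool _)%:R.
case: (nat_of_ord j =P i.+1) => [e|]; last by rewrite andbF.
have := ltn_ord j; rewrite e => ltj.
rewrite !reshape_index_nseq2 !reshape_index_cons.
by case: (ltnP i (2 * r)) => [lti|lei]; case: ltnP => [ltSi|leSi]; repeat case: ltnP => ?; lia.
Qed.

(** The brackets with X_1 are those of [mu0]. *)
Definition standard_net (A : 'I_r -> 'M[K]_r.+2) :=
  forall k j, A k ord0 j = (j == k.+1 :> nat)%:R.

(* The permutation exchanges the basis X_1, ..., X_2p with the Jordan basis
   X_3, X_2, X_5, X_4, ..., X_(2p-1), X_(2p-2), X_1, X_2p of ad X_1. *)
Definition jordan_shift (x : 'I_n) : 'I_n :=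
  insubd x (if odd x then nat_of_ord x else if (x < 2 * r)%N then (x + 2)%N else 0%N).

Lemma val_jordan_shift x : jordan_shift x =
  (if odd x then nat_of_ord x else if (x < 2 * r)%N then (x + 2)%N else 0%N) :> nat.
Proof.
rewrite /jordan_shift val_insubd; case: ifP => //.
have := ltn_ord x; do 2?[case: ifP => ?]; lia.
Qed.

Variable A : 'I_r -> 'M[K]_r.+2.
Hypotheses (skewA : forall k, skew (A k)) (stdA : standard_net A).
Let mu := bilin_of A.
Let X1 : 'cV[K]_n := delta_mx (vwi (inl ord0)) 0.

Let two_nilp_mu : two_nilp mu.
Proof. by apply: two_nilp_of_net => [||k]; [apply: vw_indexK | apply: vw_splitK | apply: skewA]. Qed.

Let ad_X1 i j : ad mu X1 i j = (odd j && (i == j.+1 :> nat))%:R.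
Proof.
rewrite mxE bracket_delta -(vw_splitK i) -(vw_splitK j) ffunE /= !vw_indexK.
case: (vw_split j) => [j' | k] /=; last first.
  by rewrite mxE mul2n odd_double.
rewrite summxE; case: (vw_split i) => [i' | k] /=.
  rewrite big1 => [|k _]; last by rewrite !mxE (h_eq (@vw_indexK r)) mulr0.
  case: andP => // -[o /eqP e]; have := ltn_ord i'; move: o e.
  by case: (nat_of_ord i') => [|i'']; case: (nat_of_ord j') => [|j'']; lia.
rewrite (bigD1 k) //= big1 ?addr0 => [|l /negPf ne_lk].
  have -> : inord 0 = ord0 :> 'I_r.+2 by apply: val_inj; rewrite /= inordK.
  rewrite mxE stdA mxE !eqxx mulr1; congr (nat_of_bool _)%:R.
  by case: (nat_of_ord j') => [|j'']; lia.
by rewrite mxE [delta_mx _ _ _ _]mxE (h_eq (@vw_indexK r)) (inj_eq (@inr_inj _ _)) eq_sym ne_lk mulr0.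
Qed.

Let X1_underived : ~ in_derived mu X1.
Proof.
(* The test subspace is the kernel of the X_1-coordinate, which vanishes on every bracket. *)
move/(_ (lker (linfun (mulmx (delta_mx 0 (vwi (inl ord0)) : 'rV[K]_n))))).
set U := lker _ => X1U; have /X1U : forall Y Z, bracket mu Y Z \in U.
  move=> Y Z; rewrite memv_ker lfunE /=.
  apply/eqP/matrixP => a b; rewrite -rowE !mxE !ord1.
  exact: (bracket_of_net_inl (@vw_indexK r) (@vw_splitK r)).
rewrite memv_ker lfunE /= mul_delta_mx => /eqP/matrixP/(_ 0 0).
by rewrite !mxE !eqxx => /eqP; rewrite oner_eq0.
Qed.

Let shift_inj : injective jordan_shift.
Proof.
move=> x y /(congr1 val) /=; rewrite !val_jordan_shift => e; apply: val_inj => /=.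
have ltx := ltn_ord x; have lty := ltn_ord y; move: e.
by do 4?[case: ifP => ?]; lia.
Qed.

Let jordan_X1 : jordan_sizes (ad mu X1) (nseq r 2%N ++ [:: 1%N; 1%N]).
Proof.
split.
- by case: (r) => // m; elim: m => //= m ->.
- by rewrite mem_cat negb_or andbT; apply/negP => /nseqP[].
- by rewrite sumn_cat sumn_nseq /=; lia.
pose s := perm shift_inj; exists (perm_mx s); first exact: unitmx_perm.
apply/simmxP; first exact: unitmx_perm.
have -> : jordan_nilp K n (nseq r 2%N ++ [:: 1%N; 1%N]) = col_perm s (row_perm s (ad mu X1)).
  apply/matrixP => i j; rewrite jordan_nilp_nseq !mxE -/(ad mu X1 _ _).
  have := ad_X1 (s i) (s j); rewrite mxE => ->; rewrite !permE; congr (nat_of_bool _)%:R.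
  have lti := ltn_ord i; have ltj := ltn_ord j; rewrite !val_jordan_shift.
  by do 4?[case: ifP => ?]; lia.
by rewrite col_permE row_permE -mulmxA -perm_mxM mulVg perm_mx1 mulmx1.
Qed.

Let ad_sqr X : ad mu X *m ad mu X = 0.
Proof.
have [skew nil] := two_nilp_mu; apply/matrixP => i j.
have : ad mu X *m ad mu X *m (delta_mx j 0 : 'cV_n) = 0.
  by rewrite -mulmxA !ad_mulmx skew nil oppr0.
by move/colP/(_ i); rewrite -colE mxE => ->; rewrite !mxE.
Qed.

Let rank_ad X : (\rank (ad mu X) <= r)%N.
Proof.
have -> : ad mu X = (\matrix_(i < n, k < r) (i == vwi (inr k))%:R)
    *m (\matrix_(k < r, j < n) ad mu X (vwi (inr k)) j).
  apply/matrixP => i j; rewrite [RHS]mxE; move: i; apply: vw_indexP => [i | k].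
    rewrite mxE (bracket_of_net_inl (@vw_indexK r) (@vw_splitK r)) big1 // => k _.
    by rewrite mxE (h_eq (@vw_indexK r)) mul0r.
  rewrite (bigD1 k) //= big1 ?addr0 => [|l /negPf ne_lk].
    by rewrite mxE eqxx mul1r [in RHS]mxE.
  by rewrite mxE (h_eq (@vw_indexK r)) (inj_eq (@inr_inj _ _)) eq_sym ne_lk mul0r.
exact: leq_trans (mxrankM_maxl _ _) (rank_leq_col _).
Qed.

(** [ad_sqr] bounds the blocks by size 2, and [rank_ad] allows at most [r] blocks of size 2. *)
Let jordan_sizes_le X t : jordan_sizes (ad mu X) t ->
  ((t : seqlexi nat) <= (nseq r 2%N ++ [:: 1%N; 1%N] : seqlexi nat))%O.
Proof.
case=> sorted_t t0 sumt [P uP /(simmxRL uP) JE].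
have JJ : jordan_nilp K n t *m jordan_nilp K n t = 0.
  by rewrite JE !mulmxA mulmxKV // -(mulmxA P) ad_sqr mulmx0 mul0mx.
have rankJ : (\rank (jordan_nilp K n t) <= r)%N.
  by rewrite JE -mulmxA; apply: leq_trans (mxrankM_maxr _ _) _; apply: leq_trans (mxrankM_maxl _ _) (rank_ad X).
(* A first block of size at least 3 would put a 1 at position (0, 2) of the square. *)
have head2 : (head 0 t <= 2)%N.
  rewrite leqNgt; apply/negP => head3.
  case: t => [//|m t] /= in sorted_t t0 sumt head3 JJ JE rankJ *.
  have le3n : (2 < n)%N by lia.
  have /matrixP/(_ (Ordinal (ltn_trans (isT : 0 < 2)%N le3n)) (Ordinal le3n)) := JJ.
  rewrite mxE (bigD1 (Ordinal (ltn_trans (isT : 1 < 2)%N le3n))) //= big1 => [|l ne_l1]; last first.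
    rewrite [jordan_nilp _ _ _ _ l]mxE /=; case: eqP => [e|]; last by rewrite mul0r.
    by case/eqP: ne_l1; apply: val_inj.
  rewrite !mxE /=.
  have m0 : (0 < m)%N by lia.
  have m1 : (1 < m)%N by lia.
  rewrite !reshape_index_cons m0 m1 head3 !eqxx mulr1 addr0.
  by move/eqP; rewrite oner_eq0.
have [c [d tE]] := sorted_geq_12 sorted_t t0 head2.
have cd : (2 * c + d = n)%N by rewrite -sumt tE sumn_cat !sumn_nseq; lia.
rewrite tE; apply: lexi_nseq => //; rewrite leqNgt; apply/negP => lt_rc.
have [cE dE] : c = r.+1 /\ d = 0%N by lia.
(* With [r.+1] blocks of size 2, the even rows and odd columns cut out an identity matrix of size
   [r.+1], against [rankJ]. *)
have : (\rank (1%:M : 'M[K]_r.+1) <= r)%N; last by rewrite mxrank1 ltnn.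
apply: leq_trans rankJ.
have lt_even (k : 'I_r.+1) : (2 * k < n)%N by have := ltn_ord k; lia.
have lt_odd (k : 'I_r.+1) : ((2 * k).+1 < n)%N by have := ltn_ord k; lia.
pose f k := Ordinal (lt_even k); pose g k := Ordinal (lt_odd k).
have <- : rowsub f 1%:M *m jordan_nilp K n t *m colsub g 1%:M = 1%:M.
  rewrite -rowsubE mulmx_colsub mulmx1; apply/matrixP => k l; rewrite !mxE tE cE !reshape_index_nseq2 /=.
  have ltk := ltn_ord k; have ltl := ltn_ord l.
  rewrite -val_eqE /=; congr (nat_of_bool _)%:R.
  by do 2?[case: ifP => ?]; lia.
by rewrite -mulmxA; apply: leq_trans (mxrankM_maxr _ _) (mxrankM_maxl _ _).
Qed.

Lemma charseq_bilin_of_net : charseq_family (bilin_of A).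
Proof.
split; first exact: two_nilp_mu.
split; first by exists X1; [apply: X1_underived | apply: jordan_X1].
by move=> X t _; apply: jordan_sizes_le.
Qed.

End CharacteristicSequence.
(** * Rigidity of g6 and g8 *)

Section Rigidity.
Variable K : closedFieldType.
Hypothesis charK0 : [pchar K] =i pred0.

Let two_neq0 : 2 != 0 :> K.
Proof. by move: charK0 => /pcharf0P ->. Qed.

(** Where [F] does not vanish, the nets of [mu] and of a neighbour are both equivalent to [N], hence
    to each other. *)
Lemma rigid_of_net r (mu : bilin K (2 * r.+1)) (N : 'I_r -> 'M[K]_r.+2)
    (F : ('I_r -> 'M[K]_r.+2) -> K) :
    graded mu -> standard_net (net_of (@vw_index r) mu) ->
    (forall w : 'rV_r.+2, (forall k, w *m net_of (@vw_index r) mu k = 0) -> w = 0) ->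
    polyfun (fun nu : bilin K (2 * r.+1) => F (net_of (@vw_index r) nu)) ->
    (forall A : 'I_r -> 'M[K]_r.+2, (forall k, skew (A k)) -> F A != 0 -> net_equiv A N) ->
    F (net_of (@vw_index r) mu) != 0 ->
  rigid mu.
Proof.
move=> gr_mu std rad pF normal Fmu.
have muE := graded_bilin_of_net gr_mu.
have sk k : skew (net_of (@vw_index r) mu k) by apply: graded_net_skew.
apply: (rigid_of_neighbourhood _ pF Fmu).
  rewrite muE; apply: two_nilp_of_net => [||k i j]; [exact: vw_indexK | exact: vw_splitK | exact: sk].
move=> nu nu2 Fnu; rewrite muE.
(* The section comes from the brackets with X_1: by [std], the pair of V-indices 0 and k + 1 gives
   the basis vector of W of index k. *)
apply: (@orbit_of_net_equiv _ _ _ _ _ _ (@vw_indexK r) (@vw_splitK r) _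
  (fun k => (ord0, lift ord0 (lift ord_max k)))) => //.
  move=> k l /=; rewrite std /= /bump /= leqNgt ltn_ord add0n add1n eqSS.
  by rewrite eq_sym -val_eqE.
apply: net_equiv_trans (net_equiv_sym (normal _ sk Fmu)).
apply: normal Fnu => k i j; exact: net_of_skew.
Qed.

Lemma polyfun_pfq n m q (h : 'I_n.+1 + 'I_q -> 'I_m) w x y z k l :
  polyfun (fun nu : bilin K m => pfq w x y z (entry (net_of h nu k)) (entry (net_of h nu l))).
Proof.
have pe k' i j : polyfun (fun nu : bilin K m => entry (net_of h nu k') i j).
  apply: eq_polyfun (polyfun_coord K (h (inl (inord i))) (h (inl (inord j))) (h (inr k'))).
  by move=> nu; rewrite /entry mxE.
by rewrite /pfq; do ?[exact: pe | apply: polyfunD | apply: polyfunN | apply: polyfunM].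
Qed.

Lemma net_g6 k : net_of (@vw_index 2) (g6 K) k =
  if k == ord0 then wedge K 3 0 1 + wedge K 3 2 3 else wedge K 3 0 2 + wedge K 3 1 3.
Proof.
move: k; apply: forall_inord => k ltk; apply/matrixP.
apply: forall_inord => i lti; apply: forall_inord => j ltj.
rewrite mxE !ffunE -val_eqE /= !inordK // !mxE /= !inordK //.
case: k ltk => [|[|//]] _; case: i lti => [|[|[|[|//]]]] _; case: j ltj => [|[|[|[|//]]]] _ /=;
by rewrite !mxE !inordK //=; ring.
Qed.

Lemma g6_graded : graded (g6 K : bilin K (2 * 2.+1)).
Proof.
by do ?[apply: gradedD]; apply: graded_elem => // i; apply: (@basis_vec_W K 2 1) || apply: (@basis_vec_W K 2 2).
Qed.

Lemma g6_standard : standard_net (net_of (@vw_index 2) (g6 K)).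
Proof.
move=> k j; rewrite net_g6; move: k j; apply: forall_inord => k ltk; apply: forall_inord => j ltj.
rewrite -val_eqE /= !inordK //.
by case: k ltk => [|[|//]] _; case: j ltj => [|[|[|[|//]]]] _; rewrite !mxE !inordK //=; ring.
Qed.

Theorem rigid_g6 : rigid (g6 K).
Proof.
apply: (@rigid_of_net 2 (g6 K) (fun k => split_pencil K k) (fun A => \det (pencil_gram A))).
- exact: g6_graded.
- exact: g6_standard.
- move=> w w0; have := (w0 ord0, w0 (inord 1)).
  rewrite !net_g6 -!val_eqE /= inordK // => -[/rowP e0 /rowP e1].
  apply/rowP; apply: forall_inord => i lti; rewrite [RHS]mxE.
  have := (e0 (inord 0), e0 (inord 1), e0 (inord 2), e0 (inord 3)).
  rewrite !mxE !big_ord_inord !unlock /= !mxE !inordK //=.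
  rewrite !(subr0, subrr, mulr0, mul0r, addr0, add0r, mulr1, sub0r, mulrN1, mulNr).
  case=> [[[/eqP e0' /eqP e1'] /eqP e2'] /eqP e3']; move: e0' e1' e2' e3'; rewrite !oppr_eq0.
  by case: i lti => [|[|[|[|//]]]] _ /eqP ? /eqP ? /eqP ? /eqP ?.
- by apply: polyfun_det => k l; apply: eq_polyfun (polyfun_pfq _ _ _ _ _ k l) => nu; rewrite mxE.
- by move=> A sA detA; apply: net_equiv_split_pencil => //; rewrite unitmxE unitfE.
(* The two forms of [g6] are orthogonal for [pf4] and have Pfaffians 1 and -1, which [pf4]
   doubles. *)
rewrite (_ : pencil_gram _ = diag_mx (\row_k if k == ord0 then 2 else - 2)).
  rewrite det_diag; apply/prodf_neq0 => k _; rewrite mxE.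
  by case: ifP => _; rewrite ?oppr_eq0.
apply/matrixP; apply: forall_inord => i lti; apply: forall_inord => j ltj.
rewrite [LHS]mxE !net_g6 /pf4 /pfq.
case: i lti => [|[|//]] _; case: j ltj => [|[|//]] _;
by rewrite /entry !mxE -!val_eqE /= !inordK //= !mxE !inordK //=; ring.
Qed.


Definition pf5_basis (A : 'I_3 -> 'M[K]_5) : 'M[K]_5 :=
  let P a b := pf5 (A (inord a)) (A (inord b)) in
  \matrix_(x, y) match nat_of_ord y with
  | 0 => P 0 0 x 0 | 1 => P 0 1 x 0 | 2 => P 0 2 x 0 | 3 => P 1 2 x 0 | _ => P 2 2 x 0 end.

(* Cramer's rule for the coordinates of pf5 (A 1) (A 1) in the basis
   pf5_basis A; the linear relation between the six vectors pf5 (A k) (A l)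
   is then read as a quadratic form. *)
Definition pf5_conic (A : 'I_3 -> 'M[K]_5) : 'M[K]_3 :=
  let x k := (\adj (pf5_basis A) *m pf5 (A (inord 1)) (A (inord 1))) (inord k) 0 in
  \matrix_(i, j) match nat_of_ord i, nat_of_ord j with
  | 0, 0 => 2 * x 0 | 0, 1 | 1, 0 => x 1 | 0, 2 | 2, 0 => x 2
  | 1, 1 => - 2 * \det (pf5_basis A) | 1, 2 | 2, 1 => x 3 | _, _ => 2 * x 4 end.

Lemma net_equiv_generic5 (A : 'I_3 -> 'M[K]_5) :
    (forall k, skew (A k)) -> \det (pf5_basis A) * \det (pf5_conic A) != 0 ->
  net_equiv A (fun k => conic_net K k).
Proof.
move=> sA; rewrite mulf_eq0 negb_or => /andP[detM detC].
have uM : pf5_basis A \in unitmx by rewrite unitmxE unitfE.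
apply: (net_equiv_conic charK0 sA (c := pf5_conic A)).
- move=> y y0; rewrite -(mulmxK uM y) (_ : y *m pf5_basis A = 0) ?mul0mx //.
  apply/rowP; apply: forall_inord => j ltj; rewrite [RHS]mxE.
  have coord a b : \sum_i y 0 i * pf5 (A (inord a)) (A (inord b)) i 0 = 0.
    have /matrixP/(_ (inord a) (inord b)) := y0.
    rewrite summxE [in RHS]mxE => e; rewrite -[RHS]e.
    by apply: eq_bigr => i _; rewrite [RHS]mxE [pf5_gram _ _ _ _]mxE.
  rewrite mxE; under eq_bigr do rewrite mxE inordK //.
  by case: j ltj => [|[|[|[|[|//]]]]] _; apply: coord.
- apply/matrixP; apply: forall_inord => i lti; apply: forall_inord => j ltj.
  by rewrite !mxE !inordK //; case: i lti => [|[|[|//]]] _; case: j ltj => [|[|[|//]]] _.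
- by rewrite unitmxE unitfE.
move=> i.
(* Twice this Cramer identity is the required relation: off-diagonal entries of the conic count
   twice in the trace, so the diagonal ones carry a factor 2. *)
have e : (pf5_basis A *m (\adj (pf5_basis A) *m pf5 (A (inord 1)) (A (inord 1)))) i 0
    = \det (pf5_basis A) * pf5 (A (inord 1)) (A (inord 1)) i 0.
  by rewrite mulmxA mul_mx_adj mul_scalar_mx [LHS]mxE.
move: e; rewrite [LHS in LHS = _ -> _]mxE /mxtrace !big_ord_inord unlock /=.
rewrite ![(pf5_conic A *m _) _ _]mxE !big_ord_inord unlock /=.
rewrite ![pf5_conic _ _ _]mxE ![pf5_gram _ _ _ _]mxE ![pf5_basis _ _ _]mxE !inordK //=.
rewrite (pf5C (A (inord 1)) (A (inord 0))) (pf5C (A (inord 2)) (A (inord 0))) (pf5C (A (inord 2)) (A (inord 1))) => e.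
transitivity (2 * (\det (pf5_basis A) * pf5 (A (inord 1)) (A (inord 1)) i 0) - 2 * (\det (pf5_basis A) * pf5 (A (inord 1)) (A (inord 1)) i 0)).
  by rewrite -{1}e; ring.
by rewrite subrr.
Qed.

Lemma polyfun_pf5 n q (h : 'I_5 + 'I_q -> 'I_n) k l i :
  polyfun (fun nu : bilin K n => pf5 (net_of h nu k) (net_of h nu l) i 0).
Proof.
apply: (@eq_polyfun _ _ (fun nu => match nat_of_ord i with
  | 0 => pfq 1 2 3 4 (entry (net_of h nu k)) (entry (net_of h nu l))
  | 1 => - pfq 0 2 3 4 (entry (net_of h nu k)) (entry (net_of h nu l))
  | 2 => pfq 0 1 3 4 (entry (net_of h nu k)) (entry (net_of h nu l))
  | 3 => - pfq 0 1 2 4 (entry (net_of h nu k)) (entry (net_of h nu l))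
  | _ => pfq 0 1 2 3 (entry (net_of h nu k)) (entry (net_of h nu l))
  end)); first by move=> nu; rewrite mxE.
by case: (nat_of_ord i) => [|[|[|[|?]]]]; do ?[apply: polyfunN]; apply: polyfun_pfq.
Qed.

(** The adjugate in place of an inverse keeps the conic polynomial in the structure constants. *)
Lemma polyfun_generic5 n (h : 'I_5 + 'I_3 -> 'I_n) :
  polyfun (fun nu : bilin K n =>
    \det (pf5_basis (net_of h nu)) * \det (pf5_conic (net_of h nu))).
Proof.
have pM i j : polyfun (fun nu : bilin K n => pf5_basis (net_of h nu) i j).
  pose P a b (nu : bilin K n) := pf5 (net_of h nu (inord a)) (net_of h nu (inord b)) i 0.
  apply: (@eq_polyfun _ _ (fun nu => match nat_of_ord j with
    | 0 => P 0 0 nu | 1 => P 0 1 nu | 2 => P 0 2 nu | 3 => P 1 2 nu | _ => P 2 2 nu end)).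
    by move=> nu; rewrite mxE.
  by case: (nat_of_ord j) => [|[|[|[|?]]]]; apply: polyfun_pf5.
have pdet : polyfun (fun nu : bilin K n => \det (pf5_basis (net_of h nu))) by apply: polyfun_det.
apply: polyfunM => //; apply: polyfun_det => i j.
pose x k (nu : bilin K n) := (\adj (pf5_basis (net_of h nu))
  *m pf5 (net_of h nu (inord 1)) (net_of h nu (inord 1))) (inord k) 0.
have px k : polyfun (x k).
  apply: polyfun_mulmx => [a b | a b]; first exact: polyfun_adj.
  by rewrite (ord1 b); apply: polyfun_pf5.
apply: (@eq_polyfun _ _ (fun nu => match nat_of_ord i, nat_of_ord j with
  | 0, 0 => 2 * x 0 nu | 0, 1 | 1, 0 => x 1 nu | 0, 2 | 2, 0 => x 2 nu
  | 1, 1 => - 2 * \det (pf5_basis (net_of h nu)) | 1, 2 | 2, 1 => x 3 nu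
  | _, _ => 2 * x 4 nu end)).
  by move=> nu; rewrite mxE.
by case: (nat_of_ord i) => [|[|[|?]]]; case: (nat_of_ord j) => [|[|[|?]]];
  do ?[exact: px | exact: pdet | apply: polyfunM | exact: polyfun_const].
Qed.

Lemma net_g8 k : net_of (@vw_index 3) (g8 K) k = match nat_of_ord k with
  | 0 => wedge K 4 0 1 + wedge K 4 2 4
  | 1 => wedge K 4 0 2 + wedge K 4 3 4
  | _ => wedge K 4 0 3 + wedge K 4 1 2 end.
Proof.
move: k; apply: forall_inord => k ltk; apply/matrixP.
apply: forall_inord => i lti; apply: forall_inord => j ltj.
rewrite mxE !ffunE -?val_eqE /= !inordK // !mxE /= !inordK //.
case: k ltk => [|[|[|//]]] _; case: i lti => [|[|[|[|[|//]]]]] _; case: j ltj => [|[|[|[|[|//]]]]] _ /=;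
by rewrite !mxE !inordK //=; ring.
Qed.

Lemma g8_graded : graded (g8 K : bilin K (2 * 3.+1)).
Proof.
by do ?[apply: gradedD]; apply: graded_elem => // i;
   do [apply: (@basis_vec_W K 3 1) | apply: (@basis_vec_W K 3 2) | apply: (@basis_vec_W K 3 3)].
Qed.

Lemma g8_standard : standard_net (net_of (@vw_index 3) (g8 K)).
Proof.
move=> k j; rewrite net_g8; move: k j; apply: forall_inord => k ltk; apply: forall_inord => j ltj.
rewrite !inordK //=.
by case: k ltk => [|[|[|//]]] _; case: j ltj => [|[|[|[|[|//]]]]] _; rewrite !mxE !inordK //=; ring.
Qed.

(** The net of [g8] is already in normal position: five of the vectors are nonzero multiples of
    distinct basis vectors, and P_11 = -2 P_02. *)
Lemma pf5_g8 a b x : (a < 3)%N -> (b < 3)%N -> (x < 5)%N ->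
  pf5 (net_of (@vw_index 3) (g8 K) (inord a)) (net_of (@vw_index 3) (g8 K) (inord b)) (inord x) 0
  = match a, b, x with
    | 0, 0, 3 => - 2 | 0, 1, 2 | 1, 0, 2 => 1 | 0, 2, 1 | 2, 0, 1 => 1 | 1, 1, 1 => - 2
    | 1, 2, 0 | 2, 1, 0 => 1 | 2, 2, 4 => 2 | _, _, _ => 0 end.
Proof.
move=> lta ltb ltx; rewrite !net_g8 mxE !inordK // /pfq /entry.
case: a lta => [|[|[|//]]] _; case: b ltb => [|[|[|//]]] _; case: x ltx => [|[|[|[|[|//]]]]] _;
by rewrite !mxE !inordK //=; ring.
Qed.

Theorem rigid_g8 : rigid (g8 K).
Proof.
apply: (rigid_of_net g8_graded g8_standard _ (polyfun_generic5 _) net_equiv_generic5).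
  move=> w w0; have := (w0 (inord 0), w0 (inord 1), w0 (inord 2)).
  rewrite !net_g8 !inordK // => -[[/rowP e0 /rowP e1] /rowP e2].
  apply/rowP; apply: forall_inord => i lti; rewrite [RHS]mxE.
  have := (e0 (inord 0), e0 (inord 1), e0 (inord 2), e0 (inord 4), e2 (inord 0)).
  rewrite !mxE !big_ord_inord !unlock /= !mxE !inordK //=.
  rewrite !(subr0, subrr, mulr0, mul0r, addr0, add0r, mulr1, sub0r, mulrN1, mulNr).
  case=> [[[[/eqP e0' /eqP e1'] /eqP e2'] /eqP e3'] /eqP e4'].
  move: e0' e1' e2' e3' e4'; rewrite !oppr_eq0.
  by case: i lti => [|[|[|[|[|//]]]]] _ /eqP ? /eqP ? /eqP ? /eqP ? /eqP ?.
set A := net_of _ _; have PE := pf5_g8; rewrite -/A in PE.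
have uM : pf5_basis A \in unitmx.
  apply: unitmx_inj => X MX; apply/colP; apply: forall_inord => x ltx; rewrite [RHS]mxE.
  have coord y : (pf5_basis A *m X) (inord y) 0 = 0 by rewrite MX mxE.
  have := (coord 0%N, coord 1%N, coord 2%N, coord 3%N, coord 4%N).
  rewrite ![(_ *m _) _ _]mxE !big_ord_inord unlock /= ![pf5_basis _ _ _]mxE !inordK //= !PE //=.
  rewrite !(mul0r, mul1r, add0r, addr0).
  case=> [[[[/eqP e0 /eqP e1] /eqP e2] /eqP e3] /eqP e4].
  move: e0 e1 e2 e3 e4; rewrite !mulNr !oppr_eq0 !mulf_eq0 (negPf two_neq0) /=.
  by case: x ltx => [|[|[|[|[|//]]]]] _ /eqP ? /eqP ? /eqP ? /eqP ? /eqP ?.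
have detM : \det (pf5_basis A) != 0 by rewrite -unitfE -unitmxE.
have P11 : pf5 (A (inord 1)) (A (inord 1)) = pf5_basis A *m (- 2 *: delta_mx (inord 2) 0).
  rewrite -scalemxAr -colE; apply/colP; apply: forall_inord => x ltx.
  rewrite PE // mxE [col _ _ _ _]mxE [pf5_basis _ _ _]mxE inordK // PE //.
  by case: x ltx => [|[|[|[|[|//]]]]] _ /=; rewrite ?mulr0 ?mulr1.
(* As P_11 is -2 times column 2 of the basis, Cramer's rule leaves a single nonzero coordinate,
   equal to the middle entry of the conic. *)
have CE : pf5_conic A = (- 2 * \det (pf5_basis A)) *: antidiag_mx K 2.
  have xE k : (k < 5)%N -> (\adj (pf5_basis A) *m pf5 (A (inord 1)) (A (inord 1))) (inord k) 0
      = if k == 2%N then - 2 * \det (pf5_basis A) else 0.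
    move=> ltk; rewrite P11 mulmxA mul_adj_mx mul_scalar_mx !mxE -!val_eqE /= !inordK // andbT.
    by case: eqP => _; rewrite ?mulr0 // mulr1 mulrC.
  apply/matrixP; apply: forall_inord => i lti; apply: forall_inord => j ltj.
  rewrite [LHS]mxE !xE // !mxE !inordK //.
  by case: i lti => [|[|[|//]]] _; case: j ltj => [|[|[|//]]] _ /=; rewrite ?mulr0 ?mulr1.
rewrite mulf_neq0 // CE detZ mulf_neq0 //.
  by rewrite expf_neq0 // mulf_neq0 // oppr_eq0.
by rewrite -unitfE -unitmxE unitmx_antidiag.
Qed.

End Rigidity.

(** * Membership of [g6] and [g8] in the family *)

Section FamilyMembership.
Variable K : closedFieldType.

Lemma charseq_graded r (mu : bilin K (2 * r.+1)) :
  graded mu -> standard_net (net_of (@vw_index r) mu) -> charseq_family mu.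
Proof.
move=> gr_mu std; rewrite (graded_bilin_of_net gr_mu).
by apply: charseq_bilin_of_net => // k; apply: graded_net_skew.
Qed.

Lemma lie_isomorphic_refl n (mu : bilin K n) : lie_isomorphic mu mu.
Proof. by exists 1%:M => [|X Y]; rewrite ?unitmx1 // !mul1mx. Qed.

Lemma elem_bracket0 n a b : elem_bracket a b (0 : 'cV[K]_n) = 0.
Proof. by apply/ffunP => ij; rewrite !ffunE scaler0. Qed.

Lemma C1_g6 : C1 3 (g6 K).
Proof.
split; first exact: (charseq_graded (g6_graded K) (g6_standard K)).
exists (fun i j k => (((i, j, k) == (1, 3, 2)) || ((i, j, k) == (2, 3, 1)))%N%:R).
rewrite (_ : _ + _ = g6 K); first exact: lie_isomorphic_refl.
rewrite /mu0 /phi !unlock /= !(scale0r, scale1r, add0r, addr0, elem_bracket0).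
by rewrite /g6 !addrA.
Qed.

Lemma C1_g8 : C1 4 (g8 K).
Proof.
split; first exact: (charseq_graded (g8_graded K) (g8_standard K)).
exists (fun i j k => [|| (i, j, k) == (1, 2, 3), (i, j, k) == (2, 4, 1) | (i, j, k) == (3, 4, 2)]%N%:R).
rewrite (_ : _ + _ = g8 K); first exact: lie_isomorphic_refl.
rewrite /mu0 /phi !unlock /= !(scale0r, scale1r, add0r, addr0, elem_bracket0).
by rewrite /g8 !addrA.
Qed.

End FamilyMembership.

(** * Non-rigidity *)

Section AlgebraicDependence.

(** [msize] is the degree plus one, and 0 for the zero polynomial; bounds of the form [a.+1] add up
    without nonvanishing hypotheses. *)
Lemma mpoly_degM (F : fieldType) n a b (p q : {mpoly F[n]}) :
  (msize p <= a.+1)%N -> (msize q <= b.+1)%N -> (msize (p * q) <= (a + b).+1)%N.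
Proof.
move=> pa qb; have [-> | p0] := eqVneq p 0; first by rewrite mul0r msize0.
have [-> | q0] := eqVneq q 0; first by rewrite mulr0 msize0.
by rewrite msizeM // -subn1 leq_subLR; apply: leq_trans (leq_add pa qb) _; lia.
Qed.

Lemma mpoly_degX (F : fieldType) n a k (p : {mpoly F[n]}) :
  (msize p <= a.+1)%N -> (msize (p ^+ k) <= (k * a).+1)%N.
Proof.
move=> pa; elim: k => [|k IHk]; first by rewrite expr0 msize1.
by rewrite exprS mulSn; apply: mpoly_degM.
Qed.

Lemma mpoly_deg_prod (F : fieldType) n N (p : 'I_N -> {mpoly F[n]}) (a : 'I_N -> nat) :
  (forall i, msize (p i) <= (a i).+1)%N -> (msize (\prod_i p i) <= (\sum_i a i).+1)%N.
Proof.
move=> pa; elim/big_ind2: _ => [|x b y c|//]; first by rewrite msize1.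
exact: mpoly_degM.
Qed.

(* More monomials of partial degrees < D in N variables than monomials of
   partial degrees < N D d + 1 in n variables, for D large. *)
Lemma algebraic_dependence (F : fieldType) n N (Phi : N.-tuple {mpoly F[n]}) :
  (n < N)%N -> exists2 Q : {mpoly F[N]}, Q != 0 & Q \mPo Phi = 0.
Proof.
move=> lt_nN; pose d := (\max_i msize (tnth Phi i))%N.
pose D := ((N * d).+1 ^ n).+1; pose B := (N * D * d).+1.
pose mon k l (e : {ffun 'I_k -> 'I_l}) := [multinom (e i : nat) | i < k].
pose prodPhi (e : {ffun 'I_N -> 'I_D}) := \prod_i tnth Phi i ^+ e i.
have deg_prod e : (msize (prodPhi e) <= B)%N.
  apply: leq_trans (mpoly_deg_prod (a := fun i => (e i * d)%N) _) _ => [i|].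
    by apply: mpoly_degX; apply: leqW; apply: (leq_bigmax i).
  rewrite ltnS; apply: (@leq_trans (\sum_(i < N) D * d)%N); last by rewrite sum_nat_const card_ord mulnA.
  by apply: leq_sum => i _; rewrite leq_mul2r [(e i <= D)%N]ltnW ?orbT.
pose T := {ffun 'I_N -> 'I_D}; pose S := {ffun 'I_n -> 'I_B}.
(* Rows are the power products of [Phi], columns the monomials that can occur; a row vector in the
   kernel is a linear relation between power products. *)
pose A : 'M[F]_(#|{: T}|, #|{: S}|) :=
  \matrix_(e, s) (prodPhi (enum_val e))@_(mon n B (enum_val s)).
have : kermx A != 0.
  rewrite kermx_eq0 -row_leq_rank -ltnNge; apply: leq_ltn_trans (rank_leq_col A) _.
  rewrite !card_ffun !card_ord.
  (* Hence B^n is at most D^n (N d + 1)^n, which is below D^n D by the choice of [D], and so below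
     D^N. *)
  have le_B : (B <= D * (N * d).+1)%N by rewrite /B /D; nia.
  apply: (@leq_ltn_trans ((D * (N * d).+1) ^ n)).
    by case: (n) => // k; rewrite leq_exp2r.
  have -> : (D ^ N = D ^ n * (D * D ^ (N - n.+1)))%N.
    by rewrite -expnS -expnD; congr (_ ^ _)%N; lia.
  rewrite expnMn ltn_pmul2l ?expn_gt0 //.
  by apply: (@leq_trans D) => //; rewrite leq_pmulr // expn_gt0.
case/rowV0Pn => c; rewrite sub_kermx => /eqP cA c0.
pose Q := \sum_e c 0 e *: 'X_[mon N D (enum_val e)]; exists Q.
  have [e ce0] : exists e, c 0 e != 0 by apply/rV0Pn.
  apply: contraNneq ce0 => Q0; have := congr1 (mcoeff (mon N D (enum_val e))) Q0.
  rewrite mcoeff0 raddf_sum /= (bigD1 e) //= mcoeffZ mcoeffX eqxx mulr1.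
  rewrite big1 ?addr0 => [->//|e' ne_e]; rewrite mcoeffZ mcoeffX.
  case: eqP => [/mnmP eq_m|]; rewrite ?mulr0 //; case/eqP: ne_e; apply: enum_val_inj.
  by apply/ffunP => i; apply: val_inj; have := eq_m i; rewrite !mnmE.
have QE : Q \mPo Phi = \sum_e c 0 e *: prodPhi (enum_val e).
  rewrite raddf_sum /=; apply: eq_bigr => e _; rewrite comp_mpolyZ comp_mpolyX.
  by congr (_ *: _); apply: eq_bigr => i _; rewrite mnmE.
apply/mpolyP => m; rewrite QE mcoeff0 raddf_sum /=.
have [small | /forallPn[i]] := boolP [forall i, m i < B]%N; last first.
  rewrite -leqNgt => large; apply: big1 => e _; rewrite mcoeffZ memN_msupp_eq0 ?mulr0 //.
  apply: msize_mdeg_ge; apply: leq_trans (deg_prod _) _; apply: leq_trans large _.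
  by rewrite mdegE (bigD1 i) //= leq_addr.
pose s : S := [ffun i => Ordinal (forallP small i)].
have -> : m = mon n B s by apply/mnmP => i; rewrite mnmE ffunE.
have /rowP/(_ (enum_rank s)) := cA; rewrite !mxE => e; rewrite -[RHS]e.
by apply: eq_bigr => t _; rewrite mcoeffZ mxE enum_rankK.
Qed.

Lemma digits_inj B N (a b : 'I_N -> nat) : (forall i, a i < B)%N -> (forall i, b i < B)%N ->
  (\sum_i a i * B ^ i = \sum_i b i * B ^ i)%N -> a =1 b.
Proof.
elim: N a b => [|N IHN] a b aB bB; first by move=> _ [].
have B0 : (0 < B)%N by apply: leq_ltn_trans (aB ord0).
have splitE c : (\sum_(i < N.+1) c i * B ^ i = c ord0 + (\sum_(i < N) c (lift ord0 i) * B ^ i) * B)%N.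
  rewrite big_ord_recl expn0 muln1 big_distrl; congr (_ + _)%N.
  by apply: eq_bigr => i _; rewrite /= /bump add1n expnSr mulnA.
rewrite !splitE => e; have e0 : a ord0 = b ord0.
  by have := congr1 (modn^~ B) e; rewrite /= ![(_ ord0 + _)%N]addnC !modnMDl !modn_small.
move: e; rewrite e0 => /eqP; rewrite eqn_add2l eqn_pmul2r // => /eqP /IHN IH i.
by case: (unliftP ord0 i) => [j ->|->] //; apply: (IH (fun i => aB _) (fun i => bB _)).
Qed.

(* Kronecker substitution of the powers t ^ (B ^ i) for the variables. *)
Lemma mpoly_nonvanishing (F : closedFieldType) N (Q : {mpoly F[N]}) :
  Q != 0 -> exists v, Q.@[v] != 0.
Proof.
move=> Q0; pose B := (msize Q).+1; pose w (m : 'X_{1..N}) := (\sum_i m i * B ^ i)%N.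
have small m i : m \in msupp Q -> (m i < B)%N.
  move=> /msize_mdeg_lt; rewrite mdegE (bigD1 i) //=; rewrite /B; lia.
pose p : {poly F} := \sum_(m <- msupp Q) Q@_m *: 'X^(w m).
have pE t : p.[t] = Q.@[fun i => t ^+ (B ^ i)].
  rewrite mevalE horner_sum; apply: eq_bigr => m _.
  rewrite hornerZ hornerXn; congr (_ * _); rewrite /w expr_sum.
  by apply: eq_bigr => i _; rewrite mulnC exprM.
have p0 : p != 0.
  have := Q0; rewrite -msupp_eq0; case mQ: (msupp Q) => [//|m0 s] _.
  have m0Q : m0 \in msupp Q by rewrite mQ mem_head.
  apply/eqP => /(congr1 (fun r : {poly F} => r`_(w m0))).
  rewrite coef0 coef_sum (bigD1_seq m0) //= coefZ coefXn eqxx mulr1 big1_seq => [|m /andP[ne_m mQ']].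
    by rewrite addr0 => /eqP; rewrite mcoeff_eq0 m0Q.
  rewrite coefZ coefXn; case: eqP => [e|]; rewrite ?mulr0 //.
  case/eqP: ne_m; apply/mnmP => i; symmetry; move: i; apply: digits_inj e => i; exact: small.
(* A root [t] of [p * 'X + 1] satisfies p(t) t = -1, so [p] does not vanish there. *)
have /closed_rootP[t] : size (p * 'X + 1) != 1%N.
  by rewrite size_polyDl size_mulX // ?size_poly1 ?ltnS ?size_poly_gt0 // eqSS size_poly_eq0.
rewrite rootE !hornerE => /eqP pt; exists (fun i => t ^+ (B ^ i)); rewrite -pE.
apply/eqP => pt0; move/eqP: pt; rewrite pt0 mul0r add0r; exact/negP/oner_neq0.
Qed.

End AlgebraicDependence.

Lemma card_ltn_pairs n : #|{: {ij : 'I_n * 'I_n | (ij.1 < ij.2)%N}}| = 'C(n, 2).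
Proof.
rewrite card_sig -sum1_card -(pair_big_dep xpredT (fun i j : 'I_n => (i < j)%N) (fun _ _ => 1%N)) /=.
rewrite (exchange_big_dep xpredT) //= -triangular_sum big_mkord; apply: eq_bigr => j _.
transitivity (\sum_(i < j) 1)%N; last by rewrite sum1_card card_ord.
by rewrite (big_ord_widen n (fun=> 1%N) (ltnW (ltn_ord j))).
Qed.

Section NonRigidity.
Variables (K : closedFieldType) (r : nat).
Hypothesis charK0 : [pchar K] =i pred0.
Local Notation n := (2 * r.+1)%N.
Local Notation vwi := (@vw_index r).
Local Notation bilin_of := (bilin_of_net vwi (@vw_split r)).

Let upper := {ij : 'I_r.+2 * 'I_r.+2 | (ij.1 < ij.2)%N}.
Let coords := (upper * 'I_r)%type.
Let params := ('I_r.+2 * 'I_r.+2 + 'I_r * 'I_r)%type.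
Local Notation N := #|{: coords}|.
Local Notation M := #|{: params}|.

(** Generic in [R], to serve both for scalar coordinates and for polynomial variables. *)
Let above (R : zmodType) (v : 'I_N -> R) (k : 'I_r) (i j : 'I_r.+2) : R :=
  if insub (i, j) is Some s then v (enum_rank (s : upper, k)) else 0.

Definition skew_net (v : 'I_N -> K) (k : 'I_r) : 'M[K]_r.+2 :=
  \matrix_(i, j) (above v k i j - above v k j i).

Let above_val (R : zmodType) (v : 'I_N -> R) k (s : upper) :
  above v k (val s).1 (val s).2 = v (enum_rank (s, k)).
Proof. by rewrite /above -surjective_pairing valK. Qed.

Let above_ge (R : zmodType) (v : 'I_N -> R) k (i j : 'I_r.+2) : (j <= i)%N -> above v k i j = 0.
Proof. by move=> le_ji; rewrite /above insubF //= ltnNge le_ji. Qed.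

Let skew_netP v k : skew (skew_net v k).
Proof. by move=> i j; rewrite !mxE opprB. Qed.

Lemma skew_net_upper v k (s : upper) : skew_net v k (val s).1 (val s).2 = v (enum_rank (s, k)).
Proof. by rewrite mxE above_val above_ge ?subr0 // ltnW // (valP s). Qed.

Lemma skew_net_surj (A : 'I_r -> 'M[K]_r.+2) : (forall k, skew (A k)) ->
  exists v, forall k, skew_net v k = A k.
Proof.
move=> sA; exists (fun x => A (enum_val x).2 (val (enum_val x).1).1 (val (enum_val x).1).2) => k.
have two_neq0 : 2 != 0 :> K by move: charK0 => /pcharf0P ->.
apply/matrixP => i j; rewrite mxE; case: (ltngtP i j) => [lt_ij | lt_ji | /val_inj ->].
- by rewrite [above _ _ j i]above_ge 1?ltnW // subr0 /above insubT enum_rankK.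
- by rewrite [above _ _ i j]above_ge 1?ltnW // sub0r /above insubT enum_rankK /= -sA.
- by rewrite subrr (skewE two_neq0 (sA k)) ltnn.
Qed.

Let two_nilp_skew v : two_nilp (bilin_of (skew_net v)).
Proof.
by apply: two_nilp_of_net => [||k i j]; [exact: vw_indexK | exact: vw_splitK | exact: skew_netP].
Qed.

(** Restriction to the affine space of nets: each structure constant of [bilin_of (skew_net v)] is
    zero or a coordinate of [v] up to sign. *)
Lemma skew_net_polynomial (q : {mpoly K[#|{: 'I_n * 'I_n * 'I_n}|]}) :
  exists p : {mpoly K[N]}, forall v, p.@[v] = q.@[str_consts (bilin_of (skew_net v))].
Proof.
pose e x y z : {mpoly K[N]} :=
  match @vw_split r x, @vw_split r y, @vw_split r z with
  | inl i, inl j, inr k => above (fun a => 'X_a) k i j - above (fun a => 'X_a) k j i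
  | _, _, _ => 0
  end.
have eE v x y z : (e x y z).@[v] = bilin_of (skew_net v) (x, y) z 0.
  move: x y z; apply: vw_indexP => [i | k]; apply: vw_indexP => [j | l];
    try by move=> z; rewrite ffunE /e /= !vw_indexK meval0 mxE.
  apply: vw_indexP => [i' | k]; rewrite /e !vw_indexK.
    rewrite -[in RHS]bracket_delta (bracket_of_net_inl (@vw_indexK r) (@vw_splitK r)).
    exact: meval0.
  have := net_of_bilin_of_net (@vw_indexK r) (skew_net v) k.
  move/matrixP/(_ i j); rewrite mxE => ->; rewrite mxE mevalB.
  by congr (_ - _); rewrite /above; case: insub => [s|]; rewrite ?meval0 ?mevalXU.
exists (q \mPo [tuple (let: (x, y, z) := enum_val a in e x y z) | a < _]) => v.
rewrite comp_mpoly_meval; apply: meval_eq => a.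
by rewrite tnth_mktuple /str_consts; case: (enum_val a) => -[x y] z; apply: eE.
Qed.

(* If nu = gl_act f mu with mu and nu graded, the net of nu depends only on
   the blocks V -> V of f and W -> W of its inverse. *)
Lemma orbit_polynomial (A : 'I_r -> 'M[K]_r.+2) :
  exists Phi : N.-tuple {mpoly K[M]}, forall v,
    gl_orbit (bilin_of A) (bilin_of (skew_net v)) ->
    exists u, forall x, v x = (tnth Phi x).@[u].
Proof.
pose X (a : params) : {mpoly K[M]} := 'X_(enum_rank a).
pose phi (x : coords) : {mpoly K[M]} := let: (s, k) := x in
  \sum_l X (inr (k, l)) * \sum_a \sum_b
    X (inl (a, (val s).1)) * X (inl (b, (val s).2)) * (A l a b)%:MP.
exists [tuple phi (enum_val x) | x < N] => v [f uf fE].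
pose u (x : 'I_M) : K := match enum_val x with
  | inl (a, i) => f (vwi (inl a)) (vwi (inl i))
  | inr (k, l) => invmx f (vwi (inr k)) (vwi (inr l))
  end.
have uE a : (X a).@[u] = match a with
  | inl (a, i) => f (vwi (inl a)) (vwi (inl i))
  | inr (k, l) => invmx f (vwi (inr k)) (vwi (inr l)) end.
  by rewrite mevalXU /u enum_rankK.
exists u => x; rewrite tnth_mktuple /phi; case xE: (enum_val x) => [s k].
have vE : v x = bilin_of (skew_net v) (vwi (inl (val s).1), vwi (inl (val s).2)) (vwi (inr k)) 0.
  have := net_of_bilin_of_net (@vw_indexK r) (skew_net v) k.
  move/matrixP/(_ (val s).1 (val s).2); rewrite mxE => ->.
  by rewrite skew_net_upper -xE enum_valK.
(* Brackets of [bilin_of A] have no V-coordinates, so only the block W -> W of [invmx f]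
   contributes. *)
rewrite vE fE ffunE /= mxE (sum_split (@vw_indexK r) (@vw_splitK r)) big1 ?add0r => [|i _]; last first.
  by rewrite (bracket_of_net_inl (@vw_indexK r) (@vw_splitK r)) mulr0.
rewrite raddf_sum /=; apply: eq_bigr => l _; rewrite mevalM uE; congr (_ * _).
rewrite (bracket_of_net_inr (@vw_indexK r) (@vw_splitK r)) raddf_sum /=.
apply: eq_bigr => a _; rewrite raddf_sum /=; apply: eq_bigr => b _.
by rewrite !mevalM !uE mevalC -!colE mxE [col _ _ _ _]mxE.
Qed.

Lemma net_orbit_not_dense (A : 'I_r -> 'M[K]_r.+2) : (4 <= r)%N ->
  exists2 Q : {mpoly K[N]}, Q != 0 &
    forall v, gl_orbit (bilin_of A) (bilin_of (skew_net v)) -> Q.@[v] = 0.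
Proof.
move=> le4r; have [Phi PhiE] := orbit_polynomial A.
(* The inequality (r+2)^2 + r^2 < r (r+1) (r+2) / 2 first holds at r = 4, where it reads 52 < 60. *)
have lt_MN : (M < N)%N.
  rewrite card_sum !card_prod !card_ord card_ltn_pairs.
  have : ('C(r.+2, 2) * 2 = r.+2 * r.+1)%N by have := bin_ffact r.+2 2; rewrite ffactSS ffactn1.
  nia.
have [Q Q0 QPhi] := algebraic_dependence Phi lt_MN; exists Q => // v /PhiE[u vE].
by rewrite (meval_eq _ vE) -comp_mpoly_meval QPhi meval0.
Qed.

(** If the orbit were open, an equation [q] of its complement would restrict to some [p] on nets.
    Where [p] is nonzero the net lies in the orbit, so [Q] vanishes; thus [Q * p] is zero everywhere
    and [p = 0]. All equations then hold at [nu], which lies in the orbit. *)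
Theorem C1_not_rigid (mu : bilin K n) : (4 <= r)%N -> C1 r.+1 mu -> ~ rigid mu.
Proof.
move=> le4r [_ [a /lie_isomorphic_orbit orb]] [Z [S ZE] orbE].
set nu := mu0 K r.+1 + phi r.+1 a in orb.
have gr_nu : graded nu by apply: graded_mu0_phi.
pose A := net_of vwi nu.
have [v0 v0E] : exists v, forall k, skew_net v k = A k.
  by apply: skew_net_surj => k; apply: graded_net_skew.
have nuE : nu = bilin_of (skew_net v0).
  rewrite {1}(graded_bilin_of_net gr_nu); apply/ffunP => xy; rewrite !ffunE.
  case: (vw_split xy.1) => // i; case: (vw_split xy.2) => // j.
  by apply: eq_bigr => k _; rewrite v0E.
have [_] := (orbE nu).1 (gl_orbit_sym orb); apply; apply/ZE => q Sq.
have [Q Q0 Qorb] := net_orbit_not_dense (skew_net v0) le4r.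
have [p pE] := skew_net_polynomial q.
have Qp v : (Q * p).@[v] = 0.
  rewrite mevalM; have [->|pv] := eqVneq p.@[v] 0; first by rewrite mulr0.
  rewrite Qorb ?mul0r // -nuE; apply: gl_orbit_trans orb _; apply/orbE; split; first exact: two_nilp_skew.
  by move/ZE/(_ q Sq); rewrite -pE => /eqP; apply/negP.
have p0 : p = 0.
  apply/eqP; have [//|Qp0] := boolP (p == 0).
  by have [v] := mpoly_nonvanishing (mulf_neq0 Q0 Qp0); rewrite Qp eqxx.
by rewrite nuE -pE p0 meval0.
Qed.

End NonRigidity.

Unset Implicit Arguments.

Theorem proposition13 (K : closedFieldType) (charK0 : [pchar K] =i pred0) :
  (forall (p : nat) (mu : bilin K (2 * p)),
     (5 <= p)%N -> C1 p mu -> ~ rigid mu)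
  /\ (C1 3 (g6 K) /\ rigid (g6 K))
  /\ (C1 4 (g8 K) /\ rigid (g8 K)).
Proof.
split; first by case=> [//|r] mu le5p; apply: C1_not_rigid.
by split; split; [exact: C1_g6 | exact: rigid_g6 | exact: C1_g8 | exact: rigid_g8].
Qed.
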